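(* For every real $z\ge 0$, $$E(z^2,0,z)=\frac{\sqrt\pi}{3}\exp\Bigl(\frac{5\mathrm{i}z^3}{27}\Bigr)\biggl\{\frac{1}{\Gamma(\frac56)}\,{}_2F_2\Bigl(\tfrac1{12},\tfrac7{12};\tfrac13,\tfrac23\,\Big|\,-\tfrac{32}{27}\mathrm{i}z^3\Bigr)-\frac{\mathrm{i}z}{3\Gamma(\frac76)}\,{}_2F_2\Bigl(\tfrac5{12},\tfrac{11}{12};\tfrac23,\tfrac43\,\Big|\,-\tfrac{32}{27}\mathrm{i}z^3\Bigr)\biggr\}.$$
   Context: For real $x,y,z$ the elliptic umbilic integral is $$E(x,y,z)=\frac{1}{2\pi}\iint_{\mathbb{R}^2}\exp\bigl\{-\mathrm{i}(x\xi+y\eta)-\mathrm{i}z(\xi^2+\eta^2)+\mathrm{i}(\xi^3-3\xi\eta^2)\bigr\}\,\mathrm{d}\xi\,\mathrm{d}\eta ,$$ understood as an oscillatory integral, i.e. as the limit $\varepsilon\to0^+$ of the integral with the additional factor $\mathrm{e}^{-\varepsilon(\xi^2+\eta^2)}$. Here ${}_2F_2(a_1,a_2;b_1,b_2\,|\,w)=\sum_{n\ge0}\frac{(a_1)_n(a_2)_n}{(b_1)_n(b_2)_n}\frac{w^n}{n!}$, where $(a)_n=a(a+1)\cdots(a+n-1)$. *)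

(* Defs.v *)
From mathcomp Require Import all_boot all_order all_algebra.
From mathcomp Require Import all_classical all_reals all_analysis.
From mathcomp Require Export complex.

Set Implicit Arguments.
Unset Strict Implicit.
Unset Printing Implicit Defensive.

Import Order.TTheory GRing.Theory Num.Theory numFieldNormedType.Exports.

Local Open Scope classical_set_scope.
Local Open Scope ring_scope.
Local Open Scope complex_scope.

(* Limits and series in R[i] are taken in R[i]^o, the library's topology of the
   numeric field R[i] over itself, i.e. that of the modulus. *)

Definition cexp (R : realType) (w : R[i]) : R[i] :=
  (expR (complex.Re w))%:C * (cos (complex.Im w) +i* sin (complex.Im w)).

Definition cintegral (d : measure_display) (T : measurableType d) (R : realType)
    (mu : {measure set T -> \bar R}) (D : set T) (f : T -> R[i]) : R[i] :=
  (\int[mu]_(t in D) complex.Re (f t)) +i* (\int[mu]_(t in D) complex.Im (f t)).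

(* Euler's integral, which represents the Gamma function for s > 0 only. *)
Definition Gamma (R : realType) (s : R) : R :=
  \int[lebesgue_measure]_(t in `]0, +oo[) (t `^ (s - 1) * expR (- t)).

Definition pochhammer (K : pzRingType) (a : K) (n : nat) : K :=
  \prod_(k < n) (a + k%:R).

Definition hyper2F2 (R : realType) (a1 a2 b1 b2 w : R[i]) : R[i] :=
  limn (series (fun n : nat =>
    pochhammer a1 n * pochhammer a2 n / (pochhammer b1 n * pochhammer b2 n)
    * (w ^+ n / n`!%:R)) : nat -> R[i]^o).

Definition umbilic_reg (R : realType) (x y z eps : R) : R[i]^o :=
  (2 * pi)^-1%:C *
  cintegral (@lebesgue_measure R \x @lebesgue_measure R)%E setT
    (fun p : R * R => let xi := p.1 in let eta := p.2 in
      cexp (- 'i%C * (x * xi + y * eta)%:C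
            - 'i%C * (z * (xi ^+ 2 + eta ^+ 2))%:C
            + 'i%C * (xi ^+ 3 - 3 * xi * eta ^+ 2)%:C)
      * (expR (- eps * (xi ^+ 2 + eta ^+ 2)))%:C).

Definition umbilic (R : realType) (x y z : R) : R[i]^o :=
  lim (umbilic_reg x y z eps @[eps --> 0^'+]).

(* Main.v *)
Require Import Defs.
From mathcomp Require Import all_boot all_order all_algebra.
From mathcomp Require Import all_classical all_reals all_analysis.
From mathcomp Require Import measurable_realfun ring lra.

Set Implicit Arguments.
Unset Strict Implicit.
Unset Printing Implicit Defensive.

Import Order.TTheory GRing.Theory Num.Theory numFieldNormedType.Exports.

Local Open Scope classical_set_scope.
Local Open Scope ring_scope.
Local Open Scope complex_scope.

(* All integrals are real: a complex factor e^{i beta} is carried as a phase beta inside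
   a cosine, and beta = 0, - pi/2 recover real and imaginary parts.

   After the shift xi = u - z/3 the phase becomes 5 z^3/27 + u^3 - 2 z u^2 - 3 u eta^2, whose
   quadratic form in eta has the sign of - u.  Cut the plane along u = 0; on either half,
   Cauchy's theorem allows one to rotate eta by - pi/4 and then u = r e^{i pi/6}, which turns
   the integrand into one bounded by C exp (- r (1 + s^2)) uniformly in the regularization
   parameter, so that the limit is taken under the integral.  The Gaussian integral in s and
   the substitution r = t^2 leave a multiple of
     J = Re (e^{i (beta - pi/6)} int_0^oo exp (- t^6 + 2 z e^{- i pi/6} t^4) dt).
   Expanding the exponential in powers of z produces the moments I k of t^k exp (- t^6), which
   satisfy I (k + 6) = (k + 1)/6 I k.  In the sum of the two halves the indices n = 2 mod 3
   cancel, and the indices n = 0 and n = 1 mod 3 form the two hypergeometric series.  The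
   constants come from Gamma (7/6) = I 0, Gamma (5/6) = 6 I 4 and I 0 * I 4 = pi/18. *)

(** * Integration on the half-line and on the quadrant *)

Section TrigonometricMeasurability.
Variable R : realType.

(** The choice x = z^2 is what makes the shift effective: it removes the term linear in u, while the
    shift by z/3 makes the coefficient of eta^2 proportional to u. On a rotated ray only r^2 and r^3
    then remain besides the Gaussian in s, so that a single index suffices in the expansion.

    The obstacle is that nothing converges absolutely without the regularization, whereas with it
    the obvious bounds blow up as the parameter tends to 0. The rotations and the exchange of the
    integrals are therefore done at a fixed positive parameter, with bounds depending on it;
    uniformity is asked only of the final integrand [halfPsi].

    The angle pi/6 is the one at which i u^3 becomes - r^3; the factor exp (- 3 u s^2) left by the
    rotation of eta still decays there because cos (pi/6) > 0.

    The half u < 0 is a mirror image of the other one: replacing u by - u negates the phase, up to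
    changing the signs of beta and z, and the cosine is even. The lemmas on a half-plane thus hold
    for z of either sign and are used twice. *)

Lemma is_derive_continuous (f : R -> R) (x df : R) :
  is_derive x (1 : R) f df -> {for x, continuous f}.
Proof. by move=> h; apply/differentiable_continuous/derivable1_diffP; apply: ex_derive. Qed.

Lemma scaleE (a b : R) : a *: (b : R^o) = a * b. Proof. by []. Qed.

Lemma measurable_sin : measurable_fun [set: R] (@sin R).
Proof. by apply: continuous_measurable_fun; exact: continuous_sin. Qed.

Lemma measurable_cos : measurable_fun [set: R] (@cos R).
Proof. by apply: continuous_measurable_fun; exact: continuous_cos. Qed.

End TrigonometricMeasurability.

Ltac mfun := repeat first
  [ exact: measurable_cst | exact: measurable_fst | exact: measurable_snd
  | exact: measurable_id | apply: measurable_funM | apply: measurable_funD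
  | apply: measurable_funB | apply: measurable_funN | apply: measurable_funX
  | apply: (measurableT_comp (@measurable_cos _))
  | apply: (measurableT_comp (@measurable_sin _))
  | apply: (measurableT_comp (@measurable_expR _)) ].

Section HalfPlanes.
Variable R : realType.
Local Notation mu := (@lebesgue_measure R).
Local Notation D := (`]0%R, +oo[%classic : set R).

Lemma integrable_dominated d (T : measurableType d) (m : {measure set T -> \bar R})
    (A : set T) (f g : T -> R) : measurable A -> measurable_fun A f ->
  (forall x, A x -> `|f x| <= g x) ->
  m.-integrable A (EFin \o g) -> m.-integrable A (EFin \o f).
Proof.
move=> mA mf fg ig; apply: (le_integrable mA _ _ ig); first exact/measurable_EFinP.
by move=> x Ax /=; rewrite lee_fin (le_trans (fg _ Ax))// ler_norm.
Qed.

Lemma integrable_scale d (T : measurableType d) (m : {measure set T -> \bar R})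
    (A : set T) (c : R) (f : T -> R) : measurable A ->
  m.-integrable A (EFin \o f) -> m.-integrable A (EFin \o (fun x => c * f x)).
Proof.
move=> mA iF; rewrite (_ : _ \o _ = fun x => (c%:E * (EFin \o f) x)%E)//.
exact: integrableZl.
Qed.

Lemma ge0_integrableP d (T : measurableType d) (m : {measure set T -> \bar R})
    (A : set T) (f : T -> R) : measurable_fun A f -> (forall x, A x -> 0 <= f x) ->
  m.-integrable A (EFin \o f) <-> (\int[m]_(x in A) (f x)%:E < +oo)%E.
Proof.
move=> mf f0.
have e : (\int[m]_(x in A) `|(EFin \o f) x| = \int[m]_(x in A) (f x)%:E)%E.
  by apply: eq_integral => x; rewrite inE => Ax /=; rewrite ger0_norm// f0.
split=> [/integrableP[_]|h]; first by rewrite e.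
by apply/integrableP; split; [exact/measurable_EFinP|rewrite e].
Qed.

Lemma dominated_cvg_Rintegral d (T : measurableType d) (m : {measure set T -> \bar R})
    (A : set T) (f_ : nat -> T -> R) (f g : T -> R) : measurable A ->
  (forall n, measurable_fun A (f_ n)) -> measurable_fun A f ->
  (forall x, A x -> f_ n x @[n --> \oo] --> f x) ->
  m.-integrable A (EFin \o g) -> (forall n x, A x -> `|f_ n x| <= g x) ->
  \int[m]_(x in A) f_ n x @[n --> \oo] --> \int[m]_(x in A) f x.
Proof.
move=> mA mf_ mf cf ig fg.
have [||||| intf _ cv] := @dominated_convergence _ _ _ m A mA
  (fun n x => (f_ n x)%:E) (EFin \o f) (EFin \o g).
- by move=> n; exact/measurable_EFinP.
- exact/measurable_EFinP.
- by apply: aeW => x Ax; apply: cvg_EFin; [exact: nearW | exact: cf].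
- exact: ig.
- by apply: aeW => x n Ax /=; rewrite lee_fin; exact: fg.
by apply: fine_cvg; rewrite fineK//; exact: integrable_fin_num.
Qed.

Lemma cvg_Rintegral_exhaustion (A : nat -> set R) (f : R -> R) :
  (forall n, measurable (A n)) -> (forall n, A n `<=` D) ->
  (forall x, D x -> \forall n \near \oo, A n x) ->
  mu.-integrable D (EFin \o f) ->
  \int[mu]_(x in A n) f x @[n --> \oo] --> \int[mu]_(x in D) f x.
Proof.
move=> mA AD cA iF.
have mf : measurable_fun D f by apply/measurable_EFinP; exact: (measurable_int mu).
under eq_fun => n.
  rewrite -[A n](setIidr (@AD n)) Rintegral_mkcondr; over.
apply: (@dominated_cvg_Rintegral _ _ mu D (fun n => f \_ (A n)) f (fun x => `|f x|)).
- exact: measurable_itv.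
- move=> n; apply/measurable_restrict => //; first exact: mA.
  by apply: (measurable_funS _ _ mf) => //; exact: subIsetl.
- exact: mf.
- move=> x Dx; apply: cvg_near_cst; near=> n.
  by rewrite patchE mem_set//; near: n; exact: cA.
- exact: integrable_norm.
- move=> n x Dx; rewrite patchE; case: ifP => _ //.
  by rewrite normr0.
Unshelve. all: by end_near. Qed.

Lemma integral_expRN (c : R) : 0 < c ->
  (\int[mu]_(x in D) (expR (- (c * x)))%:E = (c^-1)%:E)%E.
Proof.
move=> c0; rewrite integral_itv_obnd_cbnd; last first.
  by apply/measurable_EFinP; mfun.
rewrite (@ge0_continuous_FTC2y _ _ (fun x => - c^-1 * expR (- (c * x))) 0 0).
- by rewrite mulr0 oppr0 expR0 mulr1 EFinN oppeK add0e.
- by move=> x _; exact: expR_ge0.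
- by apply: continuous_subspaceT => x; exact: is_derive_continuous.
- rewrite -[X in _ --> X](mulr0 (- c^-1)); apply: cvgMl_tmp.
  apply: (cvg_comp (fun x => c * x) (fun x => expR (- x))); last exact: cvgr_expR.
  by apply: gt0_cvgMry => //; exact: cvg_id.
- by move=> x _; exact: ex_derive.
- apply: cvg_at_right_filter.
  suff: {for (0 : R), continuous (fun x : R => - c^-1 * expR (- (c * x)))} by [].
  exact: is_derive_continuous.
- move=> x _; rewrite derive1E.
  have h : is_derive x (1 : R) (fun x : R => - c^-1 * expR (- (c * x))) (expR (- (c * x))).
    by apply: is_derive_eq; rewrite !scaleE; field; rewrite gt_eqF.
  by rewrite derive_val.
Qed.

(** Integrability of [g] makes the integrals over []0, n.+1]] converge to the whole one, so that the
    limit of [V] is needed along the integers only and [g] may oscillate. *)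
Lemma Rintegral0y_derive (V g : R -> R) (l : R) :
  (forall x, is_derive x (1 : R) V (g x)) -> continuous g ->
  mu.-integrable D (EFin \o g) -> V n.+1%:R @[n --> \oo] --> l ->
  \int[mu]_(x in D) g x = l - V 0.
Proof.
move=> dV cg ig Vl.
have cV : continuous V by move=> x; exact: is_derive_continuous.
have h (n : nat) : \int[mu]_(x in `]0, n.+1%:R]) g x = V n.+1%:R - V 0.
  rewrite Rintegral_itv_obnd_cbnd; last first.
    apply: (integrableS _ _ _ ig) => //.
    exact: subset_itvl.
  rewrite /Rintegral (@continuous_FTC2 _ g V) //.
  - exact: continuous_subspaceT.
  - split.
    + by move=> x _; exact: ex_derive.
    + by apply: cvg_at_right_filter; exact: cV.
    + by apply: cvg_at_left_filter; exact: cV.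
  - by move=> x _; rewrite derive1E derive_val.
have := @cvg_Rintegral_exhaustion (fun n => `]0, n.+1%:R]%classic) g.
move=> /(_ _ _ _ ig) cv.
have {}cv : \int[mu]_(x in `]0, n.+1%:R]) g x @[n --> \oo] --> \int[mu]_(x in D) g x.
  apply: cv.
  - by move=> n; exact: measurable_itv.
  - by move=> n; exact: subset_itvl.
  - move=> x; rewrite /= in_itv/= andbT => x0; near=> n.
    rewrite /= in_itv/= x0/= ltW//; apply: lt_le_trans (archi_boundP (ltW x0)) _.
    rewrite ler_nat; near: n; exact: nbhs_infty_ge.
suff cv2 : \int[mu]_(x in `]0, n.+1%:R]) g x @[n --> \oo] --> l - V 0.
  exact: cvg_unique cv cv2.
under eq_fun => n do rewrite h.
by apply: cvgB => //; exact: cvg_cst.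
Unshelve. all: by end_near. Qed.

(* The integral does not depend on the parameter t when the t-derivative of the
   integrand is an exact r-derivative; reparametrizing t = t1 (1 - cos s) / 2 keeps
   t in [0, t1] for all s, so that the bounds are not needed outside. *)
Lemma Rintegral_param_const (W K V : R -> R -> R) (G : R -> R) (t1 : R) : 0 <= t1 ->
  (forall t r, is_derive t (1 : R) (W ^~ r) (K t r)) ->
  (forall t r, is_derive r (1 : R) (V t) (K t r)) ->
  (forall t, continuous (K t)) -> (forall t, continuous (W t)) ->
  (forall t, V t 0 = 0) ->
  (forall t r, 0 <= t <= t1 -> 0 < r -> `|W t r| <= G r) ->
  (forall t r, 0 <= t <= t1 -> 0 < r -> `|K t r| <= G r) ->
  (forall t, 0 <= t <= t1 -> V t n.+1%:R @[n --> \oo] --> 0) ->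
  mu.-integrable D (EFin \o G) ->
  \int[mu]_(r in D) W 0 r = \int[mu]_(r in D) W t1 r.
Proof.
move=> t10 dW dV cK cW V0 bW bK Vl iG.
have mcont (g : R -> R) : continuous g -> measurable_fun D g.
  by move=> cg; apply: measurable_funTS; exact: continuous_measurable_fun.
pose h (s : R) := t1 * ((1 - cos s) / 2).
have hI s : 0 <= h s <= t1.
  rewrite /h; have := cos_le1 s; have := cos_geN1 s => c1 c2.
  apply/andP; split; first by apply: mulr_ge0 => //; lra.
  by rewrite -[leRHS]mulr1; apply: ler_wpM2l => //; lra.
have dh s : is_derive s (1 : R) h (t1 * (sin s / 2)).
  by rewrite /h; apply: is_derive_eq; rewrite !scaleE; field.
have iK s : mu.-integrable D (EFin \o K (h s)).
  apply: (integrable_dominated _ _ _ iG); [exact: measurable_itv|exact: mcont|].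
  by move=> r; rewrite /= in_itv/= andbT => r0; exact: bK.
have iW s : mu.-integrable D (EFin \o W (h s)).
  apply: (integrable_dominated _ _ _ iG); [exact: measurable_itv|exact: mcont|].
  by move=> r; rewrite /= in_itv/= andbT => r0; exact: bW.
(* [V] vanishes at 0 and at infinity. Up to a factor depending on s alone, this integral is the
   derivative of the parametric integral. *)
have K0 s : \int[mu]_(r in D) K (h s) r = 0.
  by rewrite (Rintegral0y_derive (dV (h s)) (cK _) (iK s) (Vl _ (hI s))) V0 subr0.
pose f (s r : R) := W (h s) r.
have df s r : is_derive s (1 : R) (f ^~ r) (K (h s) r * (t1 * (sin s / 2))).
  exact: (@is_derive1_comp _ (W ^~ r) h).
have dF s : is_derive s (1 : R) (fun s => \int[mu]_(r in D) f s r) 0.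
  have p1 x r : partial1of2 f x r = K (h x) r * (t1 * (sin x / 2)).
    by rewrite partial1of2E derive_val.
  have Is : `](s - 1), (s + 1)[%classic s by rewrite /= in_itv/=; lra.
  have iG' : mu.-integrable D (EFin \o (fun r => t1 * `|G r|)).
    rewrite (_ : _ \o _ = (fun r => (t1%:E * (`|G r|)%:E)%E)); last first.
      by apply/funext => r /=; rewrite EFinM.
    by apply: integrableZl => //; exact: integrable_norm.
  have cv := @cvg_differentiation_under_integral _ _ _ mu f D (measurable_itv _) s _ _ Is
    (fun x _ => iW x) (fun x r _ _ => @ex_derive _ _ _ _ _ _ _ (df x r))
    (fun r => t1 * `|G r|) _ iG' _.
  have dlim : \int[mu]_(r in D) partial1of2 f s r = 0.
    under eq_Rintegral do rewrite p1.
    by rewrite RintegralZr ?K0 ?mul0r//; exact: measurable_itv.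
  have {}cv := cv (fun r => mulr_ge0 t10 (normr_ge0 _)).
  have dq : h^-1 *: ((fun s => \int[mu]_(r in D) f s r) (h *: 1 + s) -
      (fun s => \int[mu]_(r in D) f s r) s) @[h --> 0^'] --> (0 : R).
    under eq_fun do rewrite scaler1.
    rewrite dlim in cv; apply: cv.
    move=> x r _; rewrite /= in_itv/= andbT => r0; rewrite p1 normrM mulrC.
    rewrite ler_pM//; last by rewrite (le_trans (bK _ _ (hI x) r0))// ler_norm.
    rewrite normrM ger0_norm// -[leRHS]mulr1 ler_wpM2l//.
    have := sin_max x; rewrite normrM [X in _ * X]ger0_norm; lra.
  apply: DeriveDef; first by apply/cvg_ex; exists 0.
  exact/cvg_lim.
have h0 : h 0 = 0 by rewrite /h cos0 subrr mul0r mulr0.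
have hpi : h pi = t1 by rewrite /h cospi; field.
have := is_derive_0_is_cst 0 pi dF.
by rewrite /f h0 hpi.
Qed.

Lemma expRN_integrable : mu.-integrable D (EFin \o (fun x : R => expR (- x))).
Proof.
apply/integrableP; split; first by apply/measurable_EFinP; mfun.
under eq_integral do rewrite /= ger0_norm ?expR_ge0//.
have e : (\int[mu]_(x in D) (expR (- x))%:E = (1^-1)%:E)%E.
  by rewrite -(integral_expRN ltr01); apply: eq_integral => x _; rewrite mul1r.
by rewrite e ltry.
Qed.

Lemma exprn_le_expR (n : nat) (r : R) : 0 <= r -> r ^+ n <= n`!%:R * expR r.
Proof.
move=> r0; case: n => [|n].
  by rewrite expr0 fact0 mul1r -expR0 ler_expR.
rewrite mulrC -ler_pdivrMr ?ltr0n ?fact_gt0//.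
by apply: le_trans (expR_ge1Dxn n r0); rewrite lerDr ler01.
Qed.

Lemma cvgn_expRN : expR (- n.+1%:R) @[n --> \oo] --> (0 : R).
Proof.
have := @cvgn_expR R; rewrite -(cvg_shiftS).
by [].
Qed.

(** * Rotation of a ray of integration *)

Definition rotA (a1 a2 b2 b3 t r : R) : R :=
  r * (a1 * cos t) + r ^+ 2 * (a2 * cos (2 * t) - b2 * sin (2 * t))
  - r ^+ 3 * (b3 * sin (3 * t)).
(** The summand [t] is the argument of the Jacobian e^{i t} of u = r e^{i t}. *)
Definition rotB (a1 a2 b2 b3 t r : R) : R :=
  t + r * (a1 * sin t) + r ^+ 2 * (a2 * sin (2 * t) + b2 * cos (2 * t))
  + r ^+ 3 * (b3 * cos (3 * t)).

Lemma norm_mul_sin_le (a t : R) : `|a * sin t| <= `|a|.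
Proof. by rewrite normrM -[leRHS]mulr1 ler_wpM2l// sin_max. Qed.
Lemma norm_mul_cos_le (a t : R) : `|a * cos t| <= `|a|.
Proof. by rewrite normrM -[leRHS]mulr1 ler_wpM2l// cos_max. Qed.

(* Writing Q u = a1 u + (a2 + i b2) u^2 + i b3 u^3, the functions rotA and rotB are the
   real part of Q (r e^{i t}) and the imaginary part plus t: this is Cauchy's theorem
   for the sector between the rays of arguments 0 and t1. *)
Lemma Rintegral_rotate (a1 a2 b2 b3 beta C t1 : R) : 0 <= t1 ->
  (forall t r, 0 <= t <= t1 -> 0 < r -> rotA a1 a2 b2 b3 t r <= C - 2 * r) ->
  \int[mu]_(r in D) (expR (rotA a1 a2 b2 b3 0 r) * cos (beta + rotB a1 a2 b2 b3 0 r)) =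
  \int[mu]_(r in D) (expR (rotA a1 a2 b2 b3 t1 r) * cos (beta + rotB a1 a2 b2 b3 t1 r)).
Proof.
move=> t10 bA.
pose A := rotA a1 a2 b2 b3; pose B := rotB a1 a2 b2 b3.
pose At (t r : R) := r * (- (a1 * sin t)) + r ^+ 2 * (- (2 * a2 * sin (2 * t)) - 2 * b2 * cos (2 * t))
  - r ^+ 3 * (3 * b3 * cos (3 * t)).
pose Bt (t r : R) := 1 + r * (a1 * cos t) + r ^+ 2 * (2 * a2 * cos (2 * t) - 2 * b2 * sin (2 * t))
  - r ^+ 3 * (3 * b3 * sin (3 * t)).
pose W t r := expR (A t r) * cos (beta + B t r).
pose K t r := expR (A t r) * (At t r * cos (beta + B t r) - Bt t r * sin (beta + B t r)).
(* Cauchy-Riemann in polar form: for F = exp Q, the t-derivative of e^{i t} F (r e^{i t}) is the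
   r-derivative of i r e^{i t} F (r e^{i t}). With the phase beta included, [W] is the real part of
   the first function and [V] that of the second. *)
pose V t r := - (r * (expR (A t r) * sin (beta + B t r))).
pose P (r : R) := r * `|a1| + r ^+ 2 * (2 * `|a2| + 2 * `|b2|) + r ^+ 3 * (3 * `|b3|).
(* The weights 1, 4 and 18 come from r^k <= k! e^r for k = 1, 2, 3, applied to the terms of [P]. *)
pose c := 1 + 2 * (`|a1| + 4 * (`|a2| + `|b2|) + 18 * `|b3|).
pose G (r : R) := c * expR C * expR (- r).
(* One factor exp (- r) stays in the dominating function [G]; the other absorbs the polynomial
   factors of [K] and the factor r of [V]. *)
have eA t r : 0 <= t <= t1 -> 0 < r -> expR (A t r) <= expR C * expR (- r) * expR (- r).
  by move=> ht r0; rewrite -!expRD ler_expR (le_trans (bA _ _ ht r0))//; lra.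
have n23 t r : 0 < r -> `|At t r| <= P r /\ `|Bt t r| <= 1 + P r.
  move=> r0.
  have k (n : nat) (x y : R) : `|x| <= y -> `|r ^+ n * x| <= r ^+ n * y.
    by move=> xy; rewrite normrM ger0_norm ?ler_wpM2l// exprn_ge0// ltW.
  have nS (a s : R) : `|2 * a * sin s| <= 2 * `|a|.
    by apply: (le_trans (norm_mul_sin_le _ _)); rewrite normrM ger0_norm.
  have nC (a s : R) : `|2 * a * cos s| <= 2 * `|a|.
    by apply: (le_trans (norm_mul_cos_le _ _)); rewrite normrM ger0_norm.
  have nS3 (a s : R) : `|3 * a * sin s| <= 3 * `|a|.
    by apply: (le_trans (norm_mul_sin_le _ _)); rewrite normrM ger0_norm.
  have nC3 (a s : R) : `|3 * a * cos s| <= 3 * `|a|.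
    by apply: (le_trans (norm_mul_cos_le _ _)); rewrite normrM ger0_norm.
  split; rewrite /At /Bt /P.
    rewrite (le_trans (ler_normB _ _))// lerD//; last exact: k.
    rewrite (le_trans (ler_normD _ _))// lerD//.
      by rewrite -[X in X * _]expr1; apply: k; rewrite normrN norm_mul_sin_le.
    by apply: k; rewrite (le_trans (ler_normB _ _))// normrN lerD.
  rewrite (le_trans (ler_normB _ _))// addrA lerD//; last exact: k.
  rewrite (le_trans (ler_normD _ _))// addrA lerD//.
    rewrite (le_trans (ler_normD _ _))// normr1 lerD//.
    by rewrite -[X in X * _]expr1; apply: k; rewrite norm_mul_cos_le.
  by apply: k; rewrite (le_trans (ler_normB _ _))// lerD.
have Pc r : 0 < r -> 1 + 2 * P r <= c * expR r.
  move=> r0; have r0' := ltW r0.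
  have := exprn_le_expR 1 r0'; have := exprn_le_expR 2 r0'; have := exprn_le_expR 3 r0'.
  have := exprn_le_expR 0 r0'.
  rewrite /P /c !factS fact0 expr0 expr1 /= => e0 e1 e2 e3.
  have := normr_ge0 a1; have := normr_ge0 a2; have := normr_ge0 b2; have := normr_ge0 b3.
  move: e0 e1 e2 e3; set e := expR r; move=> e0 e1 e2 e3 p1 p2 p3 p4.
  have q1 := ler_wpM2r p4 e3; have q2 := ler_wpM2r p3 e2.
  have q3 := ler_wpM2r p2 e2; have q4 := ler_wpM2r p1 e1.
  lra.
have c1 : 1 <= c.
  by rewrite /c; have := normr_ge0 a1; have := normr_ge0 a2; have := normr_ge0 b2; have := normr_ge0 b3; lra.
apply: (@Rintegral_param_const W K V G t1 t10).
- move=> t r; rewrite /W /A /B /rotA /rotB; apply: is_derive_eq.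
  by rewrite /K /At /Bt /A /B /rotA /rotB !scaleE; ring.
- move=> t r; rewrite /V /A /B /rotA /rotB; apply: is_derive_eq.
  by rewrite /K /At /Bt /A /B /rotA /rotB !scaleE; ring.
- move=> t r; exact: is_derive_continuous.
- move=> t r; exact: is_derive_continuous.
- by move=> t; rewrite /V mul0r oppr0.
- move=> t r ht r0; rewrite (le_trans (norm_mul_cos_le _ _))// ger0_norm ?expR_ge0//.
  rewrite (le_trans (eA _ _ ht r0))// /G -[leRHS]mulr1 ler_pM ?mulr_ge0 ?expR_ge0//.
    by rewrite ler_pM ?mulr_ge0 ?expR_ge0// ler_peMl ?expR_ge0.
  by rewrite -expR0 ler_expR oppr_le0 ltW.
- move=> t r ht r0; rewrite normrM ger0_norm ?expR_ge0//.
  have [h1 h2] := n23 t r r0.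
  apply: (@le_trans _ _ (expR C * expR (- r) * expR (- r) * (c * expR r))).
    rewrite ler_pM ?expR_ge0 ?eA// (le_trans _ (Pc _ r0))// (le_trans (ler_normB _ _))//.
    have := le_trans (norm_mul_cos_le (At t r) (beta + B t r)) h1.
    have := le_trans (norm_mul_sin_le (Bt t r) (beta + B t r)) h2.
    lra.
  by rewrite /G mulrACA -mulrA [expR (- r) * expR r]mulrC expRxMexpNx_1 mulr1 mulrC mulrA.
- move=> t ht; apply/norm_cvg0P.
  apply: (@squeeze_cvgr _ _ _ _ (cst 0) (fun n => expR C * expR (- n.+1%:R))).
  + near=> n; rewrite normr_ge0/= /V normrN normrM ger0_norm//.
    have n0 : 0 < n.+1%:R :> R by [].
    apply: (@le_trans _ _ (expR n.+1%:R * (expR C * expR (- n.+1%:R) * expR (- n.+1%:R)))).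
      rewrite ler_pM//.
        by have := exprn_le_expR 1 (ltW n0); rewrite expr1 mul1r.
      by rewrite (le_trans (norm_mul_sin_le _ _))// ger0_norm ?expR_ge0// eA.
    by rewrite mulrA [expR n.+1%:R * _]mulrCA expRxMexpNx_1 mulr1.
  + exact: cvg_cst.
  + by rewrite -[X in _ --> X](mulr0 (expR C)); apply: cvgMl_tmp; exact: cvgn_expRN.
- rewrite (_ : _ \o _ = (fun r => ((c * expR C)%:E * (expR (- r))%:E)%E)); last first.
    by apply/funext => r /=; rewrite EFinM.
  by apply: integrableZl => //; exact: expRN_integrable.
Unshelve. all: by end_near. Qed.

(** * Change of variables on the half-line *)

Section substitution.
Variables (F f : R -> R).
Hypothesis dF : forall x, is_derive x (1 : R) F (f x).
Hypothesis cf : continuous f.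
Hypothesis F0 : F 0 = 0.
Hypothesis incF : {in `[0, +oo[ &, {homo F : x y / x < y}}.
Hypothesis Fy : F n.+1%:R @[n --> \oo] --> +oo.

Let cF : continuous F. Proof. by move=> x; exact: is_derive_continuous. Qed.

Let A n : set R := `[F n.+1%:R^-1, F n.+1%:R]%classic.
Let B n : set R := `[n.+1%:R^-1, n.+1%:R]%classic.

Let incF_le x y : 0 <= x -> x <= y -> F x <= F y.
Proof.
move=> x0; rewrite le_eqVlt => /predU1P[->//|xy]; apply/ltW/incF => //.
  by rewrite in_itv/= andbT.
by rewrite in_itv/= andbT (le_trans x0)// ltW.
Qed.

Let Fpos x : 0 < x -> 0 < F x.
Proof. by move=> x0; rewrite -F0; apply: incF; rewrite ?in_itv/= ?andbT// ltW. Qed.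

Let bigB : \bigcup_n B n = D.
Proof.
apply/seteqP; split => [x [n _]|x]; rewrite /B /= !in_itv/= andbT.
  by move=> /andP[+ _]; apply: lt_le_trans; rewrite invr_gt0.
move=> x0; pose N := (Num.bound x + Num.bound x^-1)%N; exists N => //=.
rewrite in_itv/=; apply/andP; split.
  rewrite -[leRHS]invrK lef_pV2 ?posrE ?invr_gt0//.
  apply/ltW; apply: lt_trans (archi_boundP _) _; first by rewrite invr_ge0 ltW.
  by rewrite ltr_nat ltnS leq_addl.
apply/ltW; apply: lt_trans (archi_boundP (ltW x0)) _.
by rewrite ltr_nat ltnS leq_addr.
Qed.

Let bigA : \bigcup_n A n = D.
Proof.
apply/seteqP; split => [x [n _]|x]; rewrite /A /= !in_itv/= andbT.
  by move=> /andP[+ _]; apply: lt_le_trans; apply: Fpos; rewrite invr_gt0.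
move=> x0.
have h1 : \forall n \near \oo, F n.+1%:R^-1 < x.
  have : F n.+1%:R^-1 @[n --> \oo] --> F 0.
    by apply: (cvg_comp harmonic F (@cvg_harmonic R)); exact: cF.
  by rewrite F0 => /cvgr_lt; apply.
have h2 : \forall n \near \oo, x <= F n.+1%:R by move/cvgryPge : Fy; apply.
near \oo => n; exists n => //=; rewrite in_itv/=; apply/andP; split.
  by apply/ltW; near: n.
by near: n.
Unshelve. all: by end_near. Qed.

Let ndB : nondecreasing_seq B.
Proof.
move=> m n mn; rewrite subsetEset; apply: subset_itv; rewrite bnd_simp.
  by rewrite lef_pV2 ?posrE// ler_nat.
by rewrite ler_nat.
Qed.

Let ndA : nondecreasing_seq A.
Proof.
move=> m n mn; rewrite subsetEset; apply: subset_itv; rewrite bnd_simp; apply: incF_le => //.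
  by rewrite lef_pV2 ?posrE// ler_nat.
by rewrite ler_nat.
Qed.

(** The half-line is exhausted by compact intervals that avoid 0 as well as infinity, since [G] is
    continuous on the open half-line only: the uses below include singularities such as r^(-1/2) and
    t^(-1/6). *)
Lemma ge0_integral_substitution0y (G : R -> R) :
  {in D, continuous G} -> (forall x, 0 < x -> 0 <= G x) ->
  (\int[mu]_(x in D) (G x)%:E = \int[mu]_(x in D) (G (F x) * f x)%:E)%E.
Proof.
move=> cG G0.
have F'E : F^`()%classic = f by apply/funext => x; rewrite derive1E derive_val.
have f0 x : 0 < x -> 0 <= f x.
  move=> x0; rewrite -F'E; apply: (@incr_derive1_ge0 _ _ `]0, +oo[).
  - by move=> y _; exact: ex_derive.
  - move=> y w; rewrite !inE/= !in_itv/= !andbT => y0 w0 yw.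
    by apply: incF; rewrite ?in_itv/= ?andbT ?ltW.
  - by rewrite interior_itv /= in_itv/= andbT.
have mG : measurable_fun D G by apply: open_continuous_measurable_fun => //; exact: interval_open.
have cGF : {in D, continuous (fun x => G (F x) * f x)}.
  move=> x; rewrite inE/= in_itv/= andbT => x0; apply: cvgM; last exact: cf.
  apply: continuous_comp; first exact: cF.
  by apply: cG; rewrite inE/= in_itv/= andbT Fpos.
have mGF : measurable_fun D (fun x => G (F x) * f x).
  by apply: open_continuous_measurable_fun => //; exact: interval_open.
have AD n : A n `<=` D by rewrite -bigA; exact: bigcup_sup.
have BD n : B n `<=` D by rewrite -bigB; exact: bigcup_sup.
have cA : (\int[mu]_(x in A n) (G x)%:E @[n --> \oo] --> \int[mu]_(x in D) (G x)%:E)%E.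
  rewrite -bigA; apply: ge0_nondecreasing_set_cvg_integral => //.
  - by move=> n; exact: measurable_itv.
  - by move=> n; apply/measurable_EFinP; exact: measurable_funS mG.
  - by move=> n x /AD; rewrite /= in_itv/= andbT lee_fin; exact: G0.
have cB : (\int[mu]_(x in B n) (G (F x) * f x)%:E @[n --> \oo] -->
    \int[mu]_(x in D) (G (F x) * f x)%:E)%E.
  rewrite -bigB; apply: ge0_nondecreasing_set_cvg_integral => //.
  - by move=> n; exact: measurable_itv.
  - by move=> n; apply/measurable_EFinP; exact: measurable_funS mGF.
  - move=> n x /BD; rewrite /= in_itv/= andbT lee_fin => x0.
    by rewrite mulr_ge0 ?f0// G0// Fpos.
have AB n : (\int[mu]_(x in A n) (G x)%:E = \int[mu]_(x in B n) (G (F x) * f x)%:E)%E.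
  rewrite /A /B (@integration_by_substitution_increasing _ F G).
  - by rewrite F'E.
  - by rewrite (@le_trans _ _ 1)// ?invf_le1// ler1n.
  - move=> x y; rewrite !in_itv/= => /andP[x0 _] /andP[y0 _] xy; apply: incF => //.
      by rewrite in_itv/= andbT (le_trans _ x0).
    by rewrite in_itv/= andbT (le_trans _ y0).
  - by rewrite F'E => x _; exact: cf.
  - by rewrite F'E; apply/cvg_ex; eexists; apply: cvg_at_right_filter; exact: cf.
  - by rewrite F'E; apply/cvg_ex; eexists; apply: cvg_at_left_filter; exact: cf.
  - split.
    + by move=> x _; exact: ex_derive.
    + by apply: cvg_at_right_filter; exact: cF.
    + by apply: cvg_at_left_filter; exact: cF.
  - apply: continuous_in_subspaceT => x; rewrite inE => /AD Dx.
    by apply: cG; rewrite inE.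
rewrite (funext AB) in cA.
exact: cvg_unique cA cB.
Qed.

(** The nonnegative case is applied to |G| + G and |G| - G, which inherit the continuity of [G]. It
    also shows that the substituted functions are integrable, which is needed to recombine them
    linearly. *)
Lemma Rintegral_substitution0y (G : R -> R) :
  {in D, continuous G} -> mu.-integrable D (EFin \o G) ->
  \int[mu]_(x in D) G x = \int[mu]_(x in D) (G (F x) * f x).
Proof.
move=> cG iG.
pose P (x : R) : R := `|G x| + G x; pose N (x : R) : R := `|G x| - G x.
have cP : {in D, continuous P}.
  by move=> x Dx; apply: cvgD; [apply: cvg_norm; exact: cG|exact: cG].
have cN : {in D, continuous N}.
  by move=> x Dx; apply: cvgB; [apply: cvg_norm; exact: cG|exact: cG].
have P0 x : 0 <= P x by rewrite /P; have := ler_norm (- G x); rewrite normrN; lra.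
have N0 x : 0 <= N x by rewrite /N; have := ler_norm (G x); lra.
have iP : mu.-integrable D (EFin \o P).
  rewrite (_ : _ \o _ = (fun x => (`|G x|%R)%:E + (G x)%:E)%E)//.
  by apply: integrableD => //; exact: integrable_norm.
have iN : mu.-integrable D (EFin \o N).
  rewrite (_ : _ \o _ = (fun x => (`|G x|%R)%:E - (G x)%:E)%E)//.
  by apply: integrableB => //; exact: integrable_norm.
have sub (H : R -> R) : {in D, continuous H} -> (forall x, 0 <= H x) ->
    mu.-integrable D (EFin \o H) ->
  mu.-integrable D (EFin \o (fun x => H (F x) * f x)) /\
  \int[mu]_(x in D) H x = \int[mu]_(x in D) (H (F x) * f x).
  move=> cH H0 iH; have e := ge0_integral_substitution0y cH (fun x _ => H0 x).
  split; last by rewrite /Rintegral e.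
  have f0 x : D x -> 0 <= f x.
    rewrite /= in_itv/= andbT => x0; rewrite (_ : f x = F^`()%classic x); last by rewrite derive1E derive_val.
    apply: (@incr_derive1_ge0 _ _ `]0, +oo[).
    - by move=> y _; exact: ex_derive.
    - move=> y w; rewrite !inE/= !in_itv/= !andbT => y0 w0 yw.
      by apply: incF; rewrite ?in_itv/= ?andbT ?ltW.
    - by rewrite interior_itv /= in_itv/= andbT.
  apply/ge0_integrableP.
  - apply: open_continuous_measurable_fun; first exact: interval_open.
    move=> x; rewrite inE/= in_itv/= andbT => x0; apply: cvgM; last exact: cf.
    apply: continuous_comp; first exact: cF.
    by apply: cH; rewrite inE/= in_itv/= andbT Fpos.
  - by move=> x Dx; rewrite mulr_ge0// f0.
  - by rewrite -e; apply/ge0_integrableP => //; apply/measurable_EFinP; exact: (measurable_int mu).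
have [iP' eP] := sub P cP P0 iP; have [iN' eN] := sub N cN N0 iN.
rewrite (_ : \int[mu]_(x in D) G x = 2^-1 * (\int[mu]_(x in D) P x - \int[mu]_(x in D) N x)).
  rewrite eP eN -RintegralB// -RintegralZl//.
    by apply: eq_Rintegral => x _; rewrite /P /N; field.
  exact: (integrableB _ iP' iN').
rewrite -RintegralB// -RintegralZl//; last exact: (integrableB _ iP iN).
by apply: eq_Rintegral => x _; rewrite /P /N; field.
Qed.

End substitution.

(** * Gaussian and Fresnel integrals *)

Lemma cvgn_natS : (n.+1%:R : R) @[n --> \oo] --> +oo.
Proof.
apply/cvgryPge => A; near=> n; rewrite (le_trans (ler_norm A))// ltW//.
apply: lt_le_trans (archi_boundP (normr_ge0 A)) _.
by rewrite ler_nat ltnW// ltnS; near: n; exact: nbhs_infty_ge.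
Unshelve. all: by end_near. Qed.

Lemma continuous_comp_gauss (k : R) : continuous (fun x : R => expR (- (k * x ^+ 2))).
Proof. by move=> x; exact: is_derive_continuous. Qed.

Lemma integral_gauss0y (k : R) : 0 < k ->
  (\int[mu]_(x in D) (expR (- (k * x ^+ 2)))%:E = (Num.sqrt (pi / k) / 2)%:E)%E.
Proof.
move=> k0; have sk : 0 < Num.sqrt k by rewrite sqrtr_gt0.
have e1 : (\int[mu]_(x in D) (expR (- x ^+ 2))%:E = (Num.sqrt pi / 2)%:E)%E.
  rewrite integral_itv_obnd_cbnd; first exact: integral0y_gauss.
  by apply/measurable_EFinP; mfun.
have h : (\int[mu]_(x in D) (expR (- x ^+ 2))%:E =
    \int[mu]_(x in D) (expR (- (Num.sqrt k * x) ^+ 2) * Num.sqrt k)%:E)%E.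
  apply: (@ge0_integral_substitution0y (fun x => Num.sqrt k * x) (fun=> Num.sqrt k) _ _ _ _ _
    (fun x => expR (- x ^+ 2))).
  - by move=> x; apply: is_derive_eq; rewrite !scaleE mulr1.
  - by move=> x; exact: cvg_cst.
  - by rewrite mulr0.
  - by move=> x y _ _ xy; rewrite ltr_pM2l.
  - apply: (cvg_comp (fun n => n.+1%:R) (fun x => Num.sqrt k * x) cvgn_natS).
    by apply: gt0_cvgMry => //; exact: cvg_id.
  - by move=> x _; exact: is_derive_continuous.
  - by move=> x _; exact: expR_ge0.
rewrite h in e1.
have e2 : (\int[mu]_(x in D) (expR (- (Num.sqrt k * x) ^+ 2) * Num.sqrt k)%:E =
    (Num.sqrt k)%:E * \int[mu]_(x in D) (expR (- (k * x ^+ 2)))%:E)%E.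
  rewrite -ge0_integralZl_EFin//; last first.
    by apply/measurable_EFinP; mfun.
  by apply: eq_integral => x _; rewrite -EFinM mulrC exprMn sqr_sqrtr ?ltW.
rewrite e2 in e1.
have -> : (Num.sqrt (pi / k) / 2)%:E = ((Num.sqrt k)^-1%:E * (Num.sqrt pi / 2)%:E)%E.
  rewrite -EFinM sqrtrM ?pi_ge0// sqrtrV ?ltW//; congr (_%:E); ring.
by rewrite -e1 muleA -EFinM mulVf ?gt_eqF// mul1e.
Qed.

Lemma Rintegral_gauss0y (k : R) : 0 < k ->
  \int[mu]_(x in D) expR (- (k * x ^+ 2)) = Num.sqrt (pi / k) / 2.
Proof. by move=> k0; rewrite /Rintegral integral_gauss0y. Qed.

(** Completing the square; this puts quadratic decay into the form [C - 2 * r] required by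
    [Rintegral_rotate]. *)
Lemma gauss_le_linear (k r : R) : 0 < k -> - (k * r ^+ 2) <= k^-1 - 2 * r.
Proof.
move=> k0; rewrite -subr_ge0.
have -> : k^-1 - 2 * r - - (k * r ^+ 2) = k * (r - k^-1) ^+ 2 by field; rewrite gt_eqF.
by rewrite mulr_ge0 ?sqr_ge0// ltW.
Qed.

Lemma cos_sin_ge1 (x : R) : 0 <= x <= pi / 2 -> [/\ 0 <= cos x, 0 <= sin x & 1 <= cos x + sin x].
Proof.
move=> /andP[x0 x1]; have p0 := pi_gt0 R.
have c0 : 0 <= cos x by apply: cos_ge0_pihalf; lra.
have s0 : 0 <= sin x by apply: sin_ge0_pi; lra.
split => //; have := cos2Dsin2 x; have := cos_le1 x; have := sin_le1 x; nra.
Qed.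

(** Turning r by - pi/4 replaces r^2 by - i r^2, so that damping and oscillation exchange their
    roles: the decay is then governed by u and survives e -> 0. *)
Lemma Rintegral_fresnel_rotate (u e g : R) : 0 < u -> 0 < e ->
  \int[mu]_(r in D) (expR (- (e * r ^+ 2)) * cos (g - u * r ^+ 2)) =
  \int[mu]_(r in D) (expR (- (u * r ^+ 2)) * cos (g - pi / 4 + e * r ^+ 2)).
Proof.
(* At the angle t the rate of decay is e cos (2 t) + u sin (2 t), which is at least min (u, e)
   because cos + sin >= 1 on [0, pi/2]. *)
move=> u0 e0; pose k := Num.min u e.
have k0 : 0 < k by rewrite lt_min u0 e0.
have ku : k <= u by rewrite ge_min lexx.
have ke : k <= e by rewrite ge_min lexx orbT.
(* [Rintegral_rotate] turns counterclockwise only, so the conjugate integrand is rotated by pi/4;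
   the cosine does not see the conjugation. *)
have := @Rintegral_rotate 0 (- e) u 0 (- g) k^-1 (pi / 4).
rewrite /rotA /rotB => h.
transitivity (\int[mu]_(r in D) (expR (rotA 0 (- e) u 0 0 r) * cos (- g + rotB 0 (- e) u 0 0 r))).
  apply: eq_Rintegral => r _; rewrite /rotA /rotB !mulr0 sin0 cos0; congr (expR _ * _); first by ring.
  by rewrite -cosN; congr cos; ring.
rewrite h.
- apply: eq_Rintegral => r _; have -> : 2 * (pi / 4) = pi / 2 :> R by field.
  rewrite cos_pihalf sin_pihalf; congr (expR _ * _); first by ring.
  by rewrite -cosN; congr cos; field.
- by rewrite divr_ge0// pi_ge0.
- move=> t r /andP[t0 t1] r0.
  have [|c0 s0 cs] := @cos_sin_ge1 (2 * t); first by apply/andP; split; lra.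
  apply: le_trans (gauss_le_linear r k0).
  have r2 : 0 <= r ^+ 2 by exact: sqr_ge0.
  have : k <= e * cos (2 * t) + u * sin (2 * t) by nra.
  move=> /(ler_wpM2r r2); lra.
Qed.

(** The integrand is the real part of e^{i g} exp (- k e^{i a} r^2). Turning r by - a/2 makes the
    exponent real, and the Jacobian contributes the phase - a/2. *)
Lemma Rintegral_gauss_rotate (k a g : R) : 0 < k -> 0 <= a < pi / 2 ->
  \int[mu]_(r in D) (expR (- (k * cos a * r ^+ 2)) * cos (g - k * sin a * r ^+ 2)) =
  cos (g - a / 2) * (Num.sqrt (pi / k) / 2).
Proof.
move=> k0 /andP[a0 api]; have p0 := pi_gt0 R.
have ca : 0 < cos a by apply: cos_gt0_pihalf; lra.
have := @Rintegral_rotate 0 (- (k * cos a)) (k * sin a) 0 (- g) (k * cos a)^-1 (a / 2).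
rewrite /rotA /rotB => h.
transitivity (\int[mu]_(r in D) (expR (rotA 0 (- (k * cos a)) (k * sin a) 0 0 r) *
    cos (- g + rotB 0 (- (k * cos a)) (k * sin a) 0 0 r))).
  apply: eq_Rintegral => r _; rewrite /rotA /rotB !mulr0 sin0 cos0; congr (expR _ * _); first by ring.
  by rewrite -cosN; congr cos; ring.
rewrite h.
- have -> : 2 * (a / 2) = a by field.
  rewrite -Rintegral_gauss0y// -RintegralZl//.
    apply: eq_Rintegral => r _; rewrite mulrC; congr (_ * expR _).
      by rewrite -cosN; congr cos; field.
    transitivity (- (k * r ^+ 2) * (cos a ^+ 2 + sin a ^+ 2)); first by ring.
    by rewrite cos2Dsin2 mulr1.
  apply/ge0_integrableP; first by mfun.
    by move=> x _; exact: expR_ge0.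
  by rewrite integral_gauss0y// ltry.
- lra.
- move=> t r /andP[t0 t1] r0.
  apply: le_trans (gauss_le_linear r _); last exact: mulr_gt0.
  (* The rate of decay at the angle t is k cos (a - 2 t), and |a - 2 t| <= a throughout the
     sector. *)
  have : cos a <= cos (a - 2 * t).
    by rewrite le_eqVlt; case: (ltgtP t 0) => [|tp|->]; [lra| |]; rewrite ?mulr0 ?subr0 ?eqxx//;
     rewrite ltr_cos ?in_itv/=; [apply/orP; right; lra|apply/andP; split; lra|apply/andP; split; lra].
  rewrite cosB => hc.
  have r2 : 0 <= k * r ^+ 2 by rewrite mulr_ge0 ?sqr_ge0 ?ltW.
  move: (ler_wpM2l r2 hc); lra.
Qed.

(** * Fubini's theorem on the quadrant *)

Lemma iterated_integral_quadrant12 (f : R * R -> \bar R) :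
  (\int[mu]_x \int[mu]_y (f \_ (D `*` D)) (x, y) =
   \int[mu]_(x in D) \int[mu]_(y in D) f (x, y))%E.
Proof.
rewrite [RHS]integral_mkcond; apply: eq_integral => x _.
rewrite [RHS]patchE; case: ifPn => xD.
  rewrite [RHS]integral_mkcond; apply: eq_integral => y _.
  by rewrite !patchE in_setX /= xD.
by apply: integral0_eq => y _; rewrite patchE in_setX /= (negbTE xD).
Qed.

Lemma iterated_integral_quadrant21 (f : R * R -> \bar R) :
  (\int[mu]_y \int[mu]_x (f \_ (D `*` D)) (x, y) =
   \int[mu]_(y in D) \int[mu]_(x in D) f (x, y))%E.
Proof.
rewrite [RHS]integral_mkcond; apply: eq_integral => y _.
rewrite [RHS]patchE; case: ifPn => yD.
  rewrite [RHS]integral_mkcond; apply: eq_integral => x _.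
  by rewrite !patchE in_setX /= yD andbT.
by apply: integral0_eq => x _; rewrite patchE in_setX /= (negbTE yD) andbF.
Qed.

Local Notation P := (@lebesgue_measure R \x @lebesgue_measure R)%E.

Lemma measurable_quadrant : measurable (D `*` D).
Proof. by apply: measurableX; exact: measurable_itv. Qed.

Lemma integral_oneDsqr0y :
  (\int[mu]_(s in D) ((1 + s ^+ 2)^-1)%:E = (pi / 2)%:E)%E.
Proof.
rewrite integral_itv_obnd_cbnd; first exact: integral0y_oneDsqr.
apply/measurable_EFinP; apply: measurable_funTS; apply: continuous_measurable_fun.
exact: continuous_oneDsqrV.
Qed.

(** Integrating over r first leaves 1 / (1 + s^2), whose integral is pi/2. This function is the
    common majorant of all the integrands on the quadrant. *)
Lemma quadrant_bound_integrable :
  P.-integrable setT (EFin \o ((fun p : R * R => expR (- (p.1 * (1 + p.2 ^+ 2)))) \_ (D `*` D))).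
Proof.
have mb : measurable_fun setT (fun p : R * R => expR (- (p.1 * (1 + p.2 ^+ 2)))) by mfun.
rewrite -restrict_EFin; apply/integrable21ltyP.
  by apply/(measurable_restrictT _ measurable_quadrant)/measurable_EFinP; exact: measurable_funTS.
set b := (EFin \o _).
have -> : (\int[mu]_y \int[mu]_x `|(b \_ (D `*` D)) (x, y)| =
    \int[mu]_y \int[mu]_x (b \_ (D `*` D)) (x, y))%E.
  apply: eq_integral => y _; apply: eq_integral => x _; rewrite gee0_abs//.
  by rewrite patchE; case: ifP => // _; rewrite lee_fin expR_ge0.
rewrite iterated_integral_quadrant21.
rewrite (_ : integral _ _ _ = (pi / 2)%:E)%E ?ltry// -integral_oneDsqr0y.
apply: eq_integral => y; rewrite inE => Dy.
have y1 : 0 < 1 + y ^+ 2 by have := sqr_ge0 y; lra.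
by rewrite -(integral_expRN y1); apply: eq_integral => x _; rewrite /b /= mulrC.
Qed.

Lemma quadrant_integrable (f : R -> R -> R) (C : R) :
  measurable_fun setT (fun p : R * R => f p.1 p.2) ->
  (forall r s, 0 < r -> 0 < s -> `|f r s| <= C * expR (- (r * (1 + s ^+ 2)))) ->
  P.-integrable setT (EFin \o ((fun p : R * R => f p.1 p.2) \_ (D `*` D))).
Proof.
move=> mf bf.
apply: (@integrable_dominated _ _ P setT _ (fun p : R * R => C *
  ((fun p : R * R => expR (- (p.1 * (1 + p.2 ^+ 2)))) \_ (D `*` D)) p)) => //.
- by apply/(measurable_restrictT _ measurable_quadrant); exact: measurable_funTS.
- move=> [r s] _; rewrite !patchE; case: ifP => [|_]; last by rewrite normr0 mulr0.
  by rewrite inE /= !in_itv/= !andbT => -[r0 s0]; exact: bf.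
- rewrite (_ : _ \o _ = fun p => (C%:E * (EFin \o
    ((fun p : R * R => expR (- (p.1 * (1 + p.2 ^+ 2)))) \_ (D `*` D))) p)%E)//.
  by apply: integrableZl => //; exact: quadrant_bound_integrable.
Qed.

(** The inner integrals are real numbers obtained through [fine], so every single slice has to be
    integrable too; the same majorant provides this, being Gaussian in s for fixed r > 0 and
    exponential in r for fixed s. *)
Lemma Rintegral_quadrant (f : R -> R -> R) (C : R) :
  measurable_fun setT (fun p : R * R => f p.1 p.2) ->
  (forall r s, 0 < r -> 0 < s -> `|f r s| <= C * expR (- (r * (1 + s ^+ 2)))) ->
  \int[P]_p ((fun p : R * R => f p.1 p.2) \_ (D `*` D)) p =
    \int[mu]_(r in D) \int[mu]_(s in D) f r s /\
  \int[P]_p ((fun p : R * R => f p.1 p.2) \_ (D `*` D)) p =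
    \int[mu]_(s in D) \int[mu]_(r in D) f r s.
Proof.
move=> mf bf; have iP := quadrant_integrable mf bf.
have iC (g : R -> R) : (\int[mu]_(x in D) (expR (g x))%:E < +oo)%E -> measurable_fun D g ->
    mu.-integrable D (EFin \o (fun x => C * expR (g x))).
  move=> ig mg; rewrite (_ : _ \o _ = fun x => (C%:E * (expR (g x))%:E)%E)//.
  apply: integrableZl => //; apply/ge0_integrableP.
  - exact: (measurableT_comp (@measurable_expR _)).
  - by move=> x _; exact: expR_ge0.
  - exact: ig.
have i1 r : D r -> mu.-integrable D (EFin \o f r).
  rewrite /= in_itv/= andbT => r0.
  apply: (@integrable_dominated _ _ mu D _ (fun s : R => C * expR (- (r * (1 + s ^+ 2))))) => //.
  - by apply: measurable_funTS; apply: (measurableT_comp mf (pair1_measurable r)).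
  - by move=> s; rewrite /= in_itv/= andbT => s0; exact: bf.
  apply: iC; last by mfun.
  apply: le_lt_trans (_ : \int[mu]_(x in D) (expR (- (r * x ^+ 2)))%:E < +oo)%E.
    apply: ge0_le_integral => //.
    + by apply/measurable_EFinP; mfun.
    + by apply/measurable_EFinP; mfun.
    + by move=> x _; rewrite lee_fin ler_expR; nra.
  by rewrite integral_gauss0y// ltry.
have i2 s : D s -> mu.-integrable D (EFin \o f ^~ s).
  rewrite /= in_itv/= andbT => s0.
  apply: (@integrable_dominated _ _ mu D _ (fun r : R => C * expR (- (r * (1 + s ^+ 2))))) => //.
  - by apply: measurable_funTS; apply: (measurableT_comp mf (pair2_measurable s)).
  - by move=> r; rewrite /= in_itv/= andbT => r0; exact: bf.
  apply: iC; last by mfun.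
  under eq_integral do rewrite mulrC.
  by rewrite integral_expRN ?ltry//; have := sqr_ge0 s; lra.
rewrite -restrict_EFin in iP.
have -> : \int[P]_p ((fun p : R * R => f p.1 p.2) \_ (D `*` D)) p =
    fine (\int[P]_p ((EFin \o (fun p : R * R => f p.1 p.2)) \_ (D `*` D)) p)%E.
  by rewrite restrict_EFin.
split; rewrite /Rintegral.
- rewrite -(integral12_prod_meas1 iP) iterated_integral_quadrant12.
  congr fine; apply: eq_integral => r; rewrite inE => Dr.
  by rewrite fineK//; apply: integrable_fin_num => //; exact: i1.
- rewrite -(integral21_prod_meas1 iP) iterated_integral_quadrant21.
  congr fine; apply: eq_integral => s; rewrite inE => Ds.
  by rewrite fineK//; apply: integrable_fin_num => //; exact: i2.
Qed.

(** The triple angle formula at pi/6, where cos (pi/2) = 0 and cos (pi/6) is positive. *)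
Lemma cos_pi6_sqr : cos (pi / 6) ^+ 2 = 3 / 4 :> R.
Proof.
have p0 := pi_gt0 R.
have c0 : 0 < cos (pi / 6 : R) by apply: cos_gt0_pihalf; lra.
have h3 : cos (pi / 2 : R) = cos (pi / 6) * (4 * cos (pi / 6) ^+ 2 - 3).
  have -> : pi / 2 = pi / 6 + (pi / 6) *+ 2 :> R by field.
  rewrite cosD cos_mulr2n sin_mulr2n.
  have := cos2Dsin2 (pi / 6 : R); set c := cos _; set s := sin _ => e.
  have es : s ^+ 2 = 1 - c ^+ 2 by rewrite -e; ring.
  by ring: es.
rewrite cos_pihalf in h3; move/esym/eqP : h3.
rewrite mulf_eq0 gt_eqF//= subr_eq0 => /eqP h; lra.
Qed.

Lemma sin_pi6 : sin (pi / 6) = 2^-1 :> R.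
Proof.
have p0 := pi_gt0 R.
have s0 : 0 < sin (pi / 6 : R) by apply: sin_gt0_pihalf; lra.
have := cos2Dsin2 (pi / 6 : R); rewrite cos_pi6_sqr => h.
have /eqP : (sin (pi / 6 : R) - 2^-1) * (sin (pi / 6) + 2^-1) = 0 by nra.
by rewrite mulf_eq0 subr_eq0 addr_eq0 => /orP[/eqP//|/eqP]; lra.
Qed.

Lemma cos_pi3 : cos (2 * (pi / 6)) = 2^-1 :> R.
Proof. by rewrite mulr_natl cos_mulr2n cos_pi6_sqr; field. Qed.

Lemma sin_pi3 : sin (2 * (pi / 6)) = cos (pi / 6) :> R.
Proof. by rewrite mulr_natl sin_mulr2n sin_pi6; field. Qed.

(** The crude lower bound is the one that gives 3 cos (pi/6) >= 1, the rate at which [halfPsi] has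
    to decay in r s^2. *)
Lemma cos_pi6_bounds : 3^-1 <= cos (pi / 6 : R) <= 1.
Proof.
have p0 := pi_gt0 R.
have c0 : 0 < cos (pi / 6 : R) by apply: cos_gt0_pihalf; lra.
have := cos_pi6_sqr => h; apply/andP; split; last exact: cos_le1.
nra.
Qed.

(** * The two half-planes *)

(* The integrand on one of the half-planes u > 0 and u < 0 after the rotation of the second
   variable (halfPhi) and of both variables (halfPsi). *)
Definition halfPhi (beta z e u s : R) : R :=
  expR (- (e * (u - z / 3) ^+ 2)) *
  (expR (- (3 * u * s ^+ 2)) *
   cos (beta + u ^+ 3 - 2 * z * u ^+ 2 - pi / 4 + e * s ^+ 2)).

Definition halfPsi (beta z e r s : R) : R :=
  expR (- (3 * cos (pi / 6) * r * s ^+ 2) + (2 * z * cos (pi / 6) * r ^+ 2 - r ^+ 3)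
        - e * (r ^+ 2 / 2 - 2 / 3 * z * cos (pi / 6) * r + z ^+ 2 / 9)) *
  cos (beta - pi / 12 - z * r ^+ 2 - 3 / 2 * r * s ^+ 2
       + e * (s ^+ 2 + z * r / 3 - cos (pi / 6) * r ^+ 2)).

Lemma measurable_halfPhi beta z e :
  measurable_fun setT (fun p : R * R => halfPhi beta z e p.1 p.2).
Proof. by rewrite /halfPhi; mfun. Qed.

Lemma measurable_halfPsi beta z e :
  measurable_fun setT (fun p : R * R => halfPsi beta z e p.1 p.2).
Proof. by rewrite /halfPsi; mfun. Qed.

(** The constant blows up as e -> 0, which does no harm: the bound serves only to exchange the two
    integrals at a fixed e. *)
Lemma halfPhi_bound beta z e u s : 0 < e -> 0 < u ->
  `|halfPhi beta z e u s| <= expR (e^-1 + `|z|) * expR (- (u * (1 + s ^+ 2))).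
Proof.
move=> e0 u0; rewrite /halfPhi mulrA (le_trans (norm_mul_cos_le _ _))//.
rewrite -expRD ger0_norm ?expR_ge0// -expRD ler_expR.
have := gauss_le_linear (u - z / 3) e0.
have : 0 <= u * s ^+ 2 by rewrite mulr_ge0 ?sqr_ge0// ltW.
have := ler_norm z; have := normr_ge0 z; lra.
Qed.

(** Beyond r = m + 1 one has r^2 (r - m) >= r^2 >= r; below it, m r^2 and r are bounded by their
    values at m + 1. *)
Lemma cubic_bound (m r : R) : 0 <= m -> 0 <= r ->
  m * r ^+ 2 - r ^+ 3 <= m * (m + 1) ^+ 2 + (m + 1) - r.
Proof.
move=> m0 r0; have [h|h] := leP r (m + 1).
  have : m * r ^+ 2 <= m * (m + 1) ^+ 2 by rewrite ler_wpM2l// lerXn2r ?nnegrE//; lra.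
  have : 0 <= r ^+ 3 by rewrite exprn_ge0.
  lra.
have k1 : 0 <= r * (r * (r - m) - 1) by apply: mulr_ge0 => //; nra.
have : 0 <= m * (m + 1) ^+ 2 by rewrite mulr_ge0 ?sqr_ge0.
nra.
Qed.

(** The constant does not involve e, and e = 0 is allowed: this is the domination under which the
    regularization is removed. *)
Lemma halfPsi_bound beta z e r s : 0 <= e <= 1 -> 0 < r ->
  `|halfPsi beta z e r s| <=
  expR (2 * `|z| * (2 * `|z| + 1) ^+ 2 + (2 * `|z| + 1) + z ^+ 2) * expR (- (r * (1 + s ^+ 2))).
Proof.
move=> /andP[e0 e1] r0; rewrite /halfPsi (le_trans (norm_mul_cos_le _ _))//.
rewrite ger0_norm ?expR_ge0// -expRD ler_expR.
have := cos_pi6_bounds; have := cos_pi6_sqr; set c := cos _ => c2 /andP[c3 c1].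
have rs : 0 <= r * s ^+ 2 by rewrite mulr_ge0 ?sqr_ge0// ltW.
have h1 : r * s ^+ 2 <= 3 * c * r * s ^+ 2 by nra.
(* The bracket is the real part of (u - z/3)^2 at u = r e^{i pi/6}. It can be negative, but
   completing the square with cos (pi/6)^2 = 3/4 shows that it is at least - z^2 / 18. *)
have h2 : - e * (r ^+ 2 / 2 - 2 / 3 * z * c * r + z ^+ 2 / 9) <= z ^+ 2.
  have -> : r ^+ 2 / 2 - 2 / 3 * z * c * r + z ^+ 2 / 9 =
      (r - 2 / 3 * z * c) ^+ 2 / 2 - 2 / 9 * z ^+ 2 * c ^+ 2 + z ^+ 2 / 9 by field.
  rewrite c2; have := sqr_ge0 (r - 2 / 3 * z * c); have := sqr_ge0 z; nra.
have h3 : 2 * z * c * r ^+ 2 <= 2 * `|z| * r ^+ 2.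
  rewrite ler_wpM2r ?sqr_ge0//; have := ler_norm z; have := normr_ge0 z; nra.
have := @cubic_bound (2 * `|z|) r; rewrite mulr_ge0// => /(_ isT (ltW r0)); lra.
Qed.

Lemma expR_cos_integrable (A B : R -> R) (C : R) :
  (forall r, 0 < r -> A r <= C - 2 * r) -> measurable_fun D A -> measurable_fun D B ->
  mu.-integrable D (EFin \o (fun r => expR (A r) * cos (B r))).
Proof.
move=> bA mA mB.
apply: (@integrable_dominated _ _ mu D _ (fun r : R => expR C * expR (- r))) => //.
- apply: measurable_funM; first exact: (measurableT_comp (@measurable_expR _)).
  exact: (measurableT_comp (@measurable_cos _)).
- move=> r; rewrite /= in_itv/= andbT => r0.
  rewrite (le_trans (norm_mul_cos_le _ _))// ger0_norm ?expR_ge0//.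
  by rewrite -expRD ler_expR (le_trans (bA _ r0))//; lra.
rewrite (_ : _ \o _ = fun r => ((expR C)%:E * (expR (- r))%:E)%E)//.
by apply: integrableZl => //; exact: expRN_integrable.
Qed.

(** The exchange takes place between the two rotations: the first one makes the integrand absolutely
    integrable on the quadrant, and the second one has to be done at fixed s, where the exponent is
    a cubic polynomial in u. *)
Lemma half_rotate (beta z e : R) : 0 < e ->
  \int[mu]_(u in D) (expR (- (e * (u - z / 3) ^+ 2)) *
    \int[mu]_(h in D) (expR (- (e * h ^+ 2)) * cos (beta + u ^+ 3 - 2 * z * u ^+ 2 - 3 * u * h ^+ 2))) =
  \int[mu]_(s in D) \int[mu]_(r in D) halfPsi beta z e r s.
Proof.
move=> e0; have p0 := pi_gt0 R.
transitivity (\int[mu]_(u in D) \int[mu]_(s in D) halfPhi beta z e u s).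
  apply: eq_Rintegral => u; rewrite inE/= in_itv/= andbT => u0.
  rewrite Rintegral_fresnel_rotate//; last by rewrite mulr_gt0.
  rewrite -RintegralZl//.
  apply: (@integrable_dominated _ _ mu D _ (fun s : R => expR (- (3 * u * s ^+ 2)))) => //.
  - by mfun.
  - by move=> s _; rewrite (le_trans (norm_mul_cos_le _ _))// ger0_norm ?expR_ge0.
  - apply/ge0_integrableP; [by mfun|by move=> s _; exact: expR_ge0|].
    by rewrite integral_gauss0y ?ltry// mulr_gt0.
have [<- ->] := Rintegral_quadrant (measurable_halfPhi beta z e)
  (fun u s u0 _ => halfPhi_bound beta z s e0 u0).
apply: eq_Rintegral => s _.
(* The exponent is a1 u - (e + 2 i z) u^2 + i u^3, where a1 collects the linear part of - e (u -
   z/3)^2 and - 3 u s^2; the constant - e z^2 / 9 is put in front of the integral. *)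
pose a1 : R := 2 / 3 * e * z - 3 * s ^+ 2.
pose b : R := 2 / 3 * e * `|z|.
have := @Rintegral_rotate a1 (- e) (- (2 * z)) 1 (beta - pi / 4 + e * s ^+ 2)
  ((2 * `|z|) ^+ 3 + (b + 2) ^+ 2 / (2 * e)) (pi / 6).
rewrite /rotA /rotB => h.
have p6 : 0 <= pi / 6 :> R by lra.
have hb t r : 0 <= t <= pi / 6 -> 0 < r -> rotA a1 (- e) (- (2 * z)) 1 t r <=
    (2 * `|z|) ^+ 3 + (b + 2) ^+ 2 / (2 * e) - 2 * r.
  move=> /andP[t0 t1] r0; rewrite /rotA.
  have c0 : 0 <= cos t by apply: cos_ge0_pihalf; lra.
  have c1 := cos_le1 t.
  have s2 : 0 <= sin (2 * t) by apply: sin_ge0_pi; lra.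
  have s31 := sin_le1 (3 * t).
  (* The cubic decay sin (3 t) r^3 degenerates as t -> 0. This inequality lets the factor sin (3 t)
     be taken out of the quadratic term 2 z sin (2 t) r^2 as well, so that the sum of the two stays
     bounded; the decay itself comes from - e cos (2 t) r^2. *)
  have s23 : sin (2 * t) <= sin (3 * t).
    move: t0; rewrite le_eqVlt => /predU1P[<-|t0]; first by rewrite !mulr0.
    by apply/ltW; rewrite ltr_sin ?in_itv/=; lra.
  have c2 : 2^-1 <= cos (2 * t).
    rewrite -cos_pi3; move: t1; rewrite le_eqVlt => /predU1P[->//|t1].
    by apply/ltW; rewrite ltr_cos ?in_itv/=; lra.
  have r2 : 0 <= r ^+ 2 by exact: sqr_ge0.
  have h1 : r * (a1 * cos t) <= b * r.
    rewrite mulrC; apply: ler_wpM2r; first exact: ltW.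
    rewrite /a1 /b; have := ler_norm z; have := normr_ge0 z; have := sqr_ge0 s.
    set x := s ^+ 2; set y := `|z| => x0 y0 zy.
    have : e * z * cos t <= e * y by rewrite -mulrA ler_wpM2l//; [exact: ltW|nra].
    have : 0 <= x * cos t by rewrite mulr_ge0.
    lra.
  have h2 : 2 * z * sin (2 * t) * r ^+ 2 - r ^+ 3 * sin (3 * t) <= (2 * `|z|) ^+ 3.
    have hz : 2 * z * sin (2 * t) <= 2 * `|z| * sin (3 * t).
      have := ler_norm z; have := normr_ge0 z; nra.
    set m := 2 * `|z| in hz *; have m0 : 0 <= m by rewrite mulr_ge0.
    apply: (@le_trans _ _ (sin (3 * t) * (m * r ^+ 2 - r ^+ 3))).
      have := ler_wpM2r r2 hz; lra.
    have [mr|rm] := leP m r.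
      apply: (@le_trans _ _ 0); last by rewrite exprn_ge0.
      rewrite mulr_ge0_le0//; first lra.
      rewrite (_ : m * r ^+ 2 - r ^+ 3 = (m - r) * r ^+ 2); last by ring.
      by rewrite mulr_le0_ge0// subr_le0.
    apply: (@le_trans _ _ (m * r ^+ 2 - r ^+ 3)).
      rewrite -[leRHS]mul1r ler_wpM2r//.
      by rewrite (_ : m * r ^+ 2 - r ^+ 3 = (m - r) * r ^+ 2); [rewrite mulr_ge0// subr_ge0 ltW|ring].
    have : m * r ^+ 2 <= m * m ^+ 2 by rewrite ler_wpM2l// lerXn2r ?nnegrE// ltW.
    have : 0 <= r ^+ 3 by rewrite exprn_ge0// ltW.
    rewrite exprS; lra.
  have h3 : - e * cos (2 * t) * r ^+ 2 <= - e / 2 * r ^+ 2.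
    have := ler_wpM2r r2 (ler_wpM2l (ltW e0) c2); lra.
  have h4 : b * r - e / 2 * r ^+ 2 <= (b + 2) ^+ 2 / (2 * e) - 2 * r.
    rewrite -subr_ge0 (_ : _ - _ = (e * r - (b + 2)) ^+ 2 / (2 * e)).
      by rewrite mulr_ge0 ?sqr_ge0// invr_ge0 mulr_ge0// ltW.
    by field; rewrite gt_eqF.
  lra.
have {}h := h p6 hb.
rewrite /rotA /rotB in hb.
transitivity (expR (- (e * z ^+ 2 / 9)) * \int[mu]_(r in D)
    (expR (rotA a1 (- e) (- (2 * z)) 1 0 r) *
     cos (beta - pi / 4 + e * s ^+ 2 + rotB a1 (- e) (- (2 * z)) 1 0 r))).
  rewrite -RintegralZl//.
    apply: eq_Rintegral => r _.
    rewrite /halfPhi /rotA /rotB [LHS]mulrA [RHS]mulrA -!expRD !mulr0 sin0 cos0 /a1.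
    by congr (expR _ * cos _); field.
  apply: (expR_cos_integrable (hb 0 ^~ _)).
  - by rewrite lexx.
  - by rewrite /rotA; mfun.
  - by rewrite /rotB; mfun.
rewrite h -RintegralZl//; last first.
  apply: (expR_cos_integrable (hb (pi / 6) ^~ _)).
  - by rewrite lexx andbT.
  - by mfun.
  - by mfun.
apply: eq_Rintegral => r _; rewrite /halfPsi [LHS]mulrA -expRD.
have -> : 3 * (pi / 6) = pi / 2 :> R by field.
rewrite cos_pihalf sin_pihalf sin_pi3 cos_pi3 sin_pi6 /a1.
by congr (expR _ * cos _); field.
Qed.

(** Dominated convergence is applied on the quadrant, between two uses of Fubini's theorem; the
    limit comes out with s innermost, ready for the Gaussian integral. *)
Lemma half_cvg (beta z : R) :
  \int[mu]_(s in D) \int[mu]_(r in D) halfPsi beta z e r s @[e --> 0^'+] -->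
  \int[mu]_(r in D) \int[mu]_(s in D) halfPsi beta z 0 r s.
Proof.
apply/cvg_at_rightP => u [u0 ul].
(* The majorant is uniform for e <= 1 only, whence the passage to a tail of the sequence. *)
have [N _ hN] : \forall n \near \oo, u n <= 1 by apply: (cvgr_le 0).
have ul' := ul; rewrite -(cvg_shiftn N) in ul'.
rewrite -(cvg_shiftn N).
have h e : 0 <= e <= 1 ->
    \int[P]_p ((fun p : R * R => halfPsi beta z e p.1 p.2) \_ (D `*` D)) p =
      \int[mu]_(r in D) \int[mu]_(s in D) halfPsi beta z e r s /\
    \int[P]_p ((fun p : R * R => halfPsi beta z e p.1 p.2) \_ (D `*` D)) p =
      \int[mu]_(s in D) \int[mu]_(r in D) halfPsi beta z e r s.
  move=> he; apply: (Rintegral_quadrant (measurable_halfPsi beta z e)).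
  by move=> r s r0 _; exact: halfPsi_bound.
have u01 n : 0 <= u (n + N)%N <= 1 by rewrite ltW//= hN//= leq_addl.
under eq_fun => n do rewrite -(h _ (u01 n)).2.
rewrite -(h 0 _).1; last by rewrite lexx ler01.
pose C := expR (2 * `|z| * (2 * `|z| + 1) ^+ 2 + (2 * `|z| + 1) + z ^+ 2).
apply: (@dominated_cvg_Rintegral _ _ P setT _ _ (fun p : R * R => C *
  ((fun p : R * R => expR (- (p.1 * (1 + p.2 ^+ 2)))) \_ (D `*` D)) p)) => //.
- move=> n; apply/(measurable_restrictT _ measurable_quadrant); apply: measurable_funTS.
  exact: measurable_halfPsi.
- apply/(measurable_restrictT _ measurable_quadrant); apply: measurable_funTS.
  exact: measurable_halfPsi.
- move=> [r s] _; rewrite !patchE; under eq_fun do rewrite patchE.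
  case: ifPn => _; last exact: cvg_cst.
  apply: (cvg_comp (fun n => u (n + N)%N) (fun e => halfPsi beta z e r s)).
    exact: ul'.
  suff : {for (0 : R), continuous (fun e => halfPsi beta z e r s)} by [].
  by rewrite /halfPsi; exact: is_derive_continuous.
- rewrite (_ : _ \o _ = fun p => (C%:E * (EFin \o
    ((fun p : R * R => expR (- (p.1 * (1 + p.2 ^+ 2)))) \_ (D `*` D))) p)%E)//.
  by apply: integrableZl => //; exact: quadrant_bound_integrable.
- move=> n [r s] _; rewrite !patchE; case: ifPn => [|_]; last by rewrite normr0 mulr0.
  by rewrite inE /= !in_itv/= !andbT => -[r0 s0]; exact: halfPsi_bound.
Qed.

Lemma sextic_bound (z t : R) : 0 <= t ->
  2 * z * cos (pi / 6) * t ^+ 4 - t ^+ 6 <=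
  2 * `|z| * (2 * `|z| + 1) ^+ 2 + (2 * `|z| + 1) + 1 - 2 * t.
Proof.
move=> t0; have /andP[b3 b1] := cos_pi6_bounds.
have h3 : 2 * z * cos (pi / 6) * t ^+ 4 <= 2 * `|z| * t ^+ 4.
  rewrite ler_wpM2r ?exprn_ge0//; have := ler_norm z; have := normr_ge0 z; nra.
have := @cubic_bound (2 * `|z|) (t ^+ 2).
rewrite mulr_ge0// -!exprM => /(_ isT (sqr_ge0 _)).
have := sqr_ge0 (t - 1); rewrite sqrrB1; lra.
Qed.

Lemma sextic_integrable (z : R) (B : R -> R) : measurable_fun D B ->
  mu.-integrable D (EFin \o (fun t => expR (2 * z * cos (pi / 6) * t ^+ 4 - t ^+ 6) * cos (B t))).
Proof.
move=> mB; apply: expR_cos_integrable => [t t0||]; [|by mfun|exact: mB].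
exact/sextic_bound/ltW.
Qed.

(* The substitution r = t^2 removes the singularity r^(-1/2) left by the Gaussian integral. *)
Lemma half_limit (beta z : R) :
  \int[mu]_(r in D) \int[mu]_(s in D) halfPsi beta z 0 r s =
  Num.sqrt (pi / 3) * \int[mu]_(t in D)
    (expR (2 * z * cos (pi / 6) * t ^+ 4 - t ^+ 6) * cos (beta - pi / 6 - z * t ^+ 4)).
Proof.
have p0 := pi_gt0 R.
pose G (r : R) : R := expR (2 * z * cos (pi / 6) * r ^+ 2 - r ^+ 3) *
  (cos (beta - pi / 6 - z * r ^+ 2) * (Num.sqrt (pi / (3 * r)) / 2)).
transitivity (\int[mu]_(r in D) G r).
  apply: eq_Rintegral => r; rewrite inE/= in_itv/= andbT => r0; rewrite /G.
  have r3 : 0 < 3 * r by rewrite mulr_gt0.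
  have a6 : 0 <= (pi / 6 : R) < pi / 2 by apply/andP; split; lra.
  (* The s-dependence is exp (- 3 r e^{i pi/6} s^2). The phase - pi/12 = - pi/4 + pi/6 stems from
     the two rotations, and the Gaussian adds another - pi/12. *)
  have := Rintegral_gauss_rotate (beta - pi / 12 - z * r ^+ 2) r3 a6.
  have -> : beta - pi / 12 - z * r ^+ 2 - pi / 6 / 2 = beta - pi / 6 - z * r ^+ 2 by field.
  move=> <-; rewrite -RintegralZl//.
    apply: eq_Rintegral => s _; rewrite /halfPsi [RHS]mulrA -expRD sin_pi6.
    by congr (expR _ * cos _); field.
  apply: (@integrable_dominated _ _ mu D _ (fun s : R => expR (- (3 * r * cos (pi / 6) * s ^+ 2)))) => //.
  - by mfun.
  - by move=> s _; rewrite (le_trans (norm_mul_cos_le _ _))// ger0_norm ?expR_ge0.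
  - apply/ge0_integrableP; [by mfun|by move=> s _; exact: expR_ge0|].
    rewrite integral_gauss0y ?ltry// mulr_gt0//; have /andP[] := cos_pi6_bounds; lra.
have dF (x : R) : is_derive x (1 : R) (fun t : R => t ^+ 2) (2 * x).
  by apply: is_derive_eq; rewrite !scaleE; ring.
have cf : continuous (fun x : R => 2 * x) by move=> x; exact: is_derive_continuous.
have F0 : (0 : R) ^+ 2 = 0 by rewrite expr0n.
have incF : {in `[(0 : R), +oo[ &, {homo (fun t : R => t ^+ 2) : x y / x < y}}.
  by move=> x y; rewrite !in_itv/= !andbT => x0 y0 xy; rewrite ltrXn2r.
have Fy : (n.+1%:R : R) ^+ 2 @[n --> \oo] --> +oo.
  by apply: (cvg_comp (fun n => n.+1%:R : R) (fun x => x ^+ 2) cvgn_natS); exact: cvgr_expr2.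
have csq : {in D, continuous (fun r : R => Num.sqrt (pi / (3 * r)) / 2)}.
  move=> r; rewrite inE/= in_itv/= andbT => r0; apply: cvgMr_tmp.
  apply: (@continuous_comp _ _ _ (fun r : R => pi / (3 * r)) Num.sqrt); last exact: sqrt_continuous.
  apply: cvgMl_tmp; apply: cvgV; first by rewrite gt_eqF// mulr_gt0.
  by apply: cvgMl_tmp; exact: cvg_id.
have sE (t : R) : 0 < t -> Num.sqrt (pi / (3 * t ^+ 2)) / 2 * (2 * t) = Num.sqrt (pi / 3).
  move=> t0; rewrite (_ : pi / (3 * t ^+ 2) = t^-1 ^+ 2 * (pi / 3)); last by field; rewrite gt_eqF.
  rewrite (@sqrtrM _ (t^-1 ^+ 2)) ?sqr_ge0// sqrtr_sqr ger0_norm; last by rewrite invr_ge0 ltW.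
  by field; rewrite gt_eqF.
have c1 : continuous (fun r : R => expR (2 * z * cos (pi / 6) * r ^+ 2 - r ^+ 3)).
  by move=> r; exact: is_derive_continuous.
have c2 : continuous (fun r : R => cos (beta - pi / 6 - z * r ^+ 2)).
  by move=> r; exact: is_derive_continuous.
have c3 : continuous (fun r : R => expR (- r)) by move=> r; exact: is_derive_continuous.
have cG : {in D, continuous G}.
  by move=> r Dr; exact: (cvgM (c1 r) (cvgM (c2 r) (csq r Dr))).
have cg : {in D, continuous (fun r : R => expR (- r) * (Num.sqrt (pi / (3 * r)) / 2))}.
  by move=> r Dr; exact: (cvgM (c3 r) (csq r Dr)).
have iG : mu.-integrable D (EFin \o G).
  pose K := expR (2 * `|z| * (2 * `|z| + 1) ^+ 2 + (2 * `|z| + 1)).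
  apply: (@integrable_dominated _ _ mu D _
    (fun r : R => K * (expR (- r) * (Num.sqrt (pi / (3 * r)) / 2)))) => //.
  - apply: open_continuous_measurable_fun; first exact: interval_open.
    exact: cG.
  - move=> r; rewrite /= in_itv/= andbT => r0; rewrite /G mulrA.
    have s0 : 0 <= Num.sqrt (pi / (3 * r)) / 2 by rewrite divr_ge0 ?sqrtr_ge0.
    rewrite normrM mulrA (ger0_norm s0) ler_wpM2r//.
    rewrite (le_trans (norm_mul_cos_le _ _))// ger0_norm ?expR_ge0// -expRD ler_expR.
    have /andP[b3 b1] := cos_pi6_bounds.
    have h3 : 2 * z * cos (pi / 6) * r ^+ 2 <= 2 * `|z| * r ^+ 2.
      rewrite ler_wpM2r ?sqr_ge0//; have := ler_norm z; have := normr_ge0 z; nra.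
    have := @cubic_bound (2 * `|z|) r; rewrite mulr_ge0// => /(_ isT (ltW r0)); lra.
  - apply: integrable_scale => //; apply/ge0_integrableP.
    + apply: open_continuous_measurable_fun; first exact: interval_open.
      exact: cg.
    + by move=> r _; rewrite mulr_ge0 ?expR_ge0// divr_ge0 ?sqrtr_ge0.
    (* Integrability of the majorant e^{- r} r^(-1/2) is obtained from the same substitution r =
       t^2, in its version for nonnegative functions. *)
    rewrite (ge0_integral_substitution0y dF cf F0 incF Fy).
    + have -> : (\int[mu]_(t in D) (expR (- t ^+ 2) * (Num.sqrt (pi / (3 * t ^+ 2)) / 2) * (2 * t))%:E =
          \int[mu]_(t in D) ((Num.sqrt (pi / 3))%:E * (expR (- (1 * t ^+ 2)))%:E))%E.
        apply: eq_integral => t; rewrite inE/= in_itv/= andbT => t0.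
        by rewrite -mulrA sE// -EFinM mulrC mul1r.
      rewrite ge0_integralZl_EFin//.
      * by rewrite integral_gauss0y// -EFinM ltry.
      * by apply/measurable_EFinP; mfun.
    + exact: cg.
    + by move=> r _; rewrite mulr_ge0 ?expR_ge0// divr_ge0 ?sqrtr_ge0.
rewrite (Rintegral_substitution0y dF cf F0 incF Fy _ iG); last first.
  exact: cG.
rewrite -RintegralZl//.
  apply: eq_Rintegral => t; rewrite inE/= in_itv/= andbT => t0.
  by rewrite /G -!mulrA [X in _ * (_ * X)]mulrA sE// -!exprM mulrA [RHS]mulrC.
by apply: sextic_integrable; mfun.
Qed.

(** * Translation and reflection of the line *)

Lemma lebesgue_measure_shift (a : R) (A : set R) : measurable A ->
  pushforward mu ((fun x => x + a) : _ -> measurableTypeR R) A = mu A.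
Proof.
move=> mA.
have ms : measurable_fun setT ((fun x => x + a) : measurableTypeR R -> measurableTypeR R) by mfun.
apply/esym/(@lebesgue_measure_unique _
  (pushforward mu ((fun x => x + a) : _ -> measurableTypeR R))) => //= _ [[u b]] _ <-.
rewrite /pushforward /=.
have -> : (fun x : R => x + a) @^-1` `]u, b]%classic = `](u - a), (b - a)]%classic.
  by apply/seteqP; split=> x /=; rewrite !in_itv/= => /andP[h1 h2]; apply/andP; split; lra.
rewrite !lebesgue_measure_itv/= !lte_fin ltrD2r; case: ifP => // _.
by rewrite -!EFinB; congr (_%:E); ring.
Qed.

Lemma Rintegral_comp_preserving (phi : R -> R) (f : R -> R) :
  measurable_fun setT phi ->
  (forall A, measurable A -> pushforward mu (phi : _ -> measurableTypeR R) A = mu A) ->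
  mu.-integrable setT (EFin \o f) ->
  mu.-integrable setT (EFin \o (f \o phi)) /\ \int[mu]_x f (phi x) = \int[mu]_x f x.
Proof.
move=> mphi pphi iF.
have mphi' : measurable_fun setT (phi : _ -> measurableTypeR R) by [].
have mf : measurable_fun setT f by apply/measurable_EFinP; exact: (measurable_int mu).
have iP : mu.-integrable setT (EFin \o (f \o phi)).
  apply/integrableP; split; first by apply/measurable_EFinP; exact: measurableT_comp.
  move/integrableP : iF => [_]; congr (_ < _)%E.
  have := @ge0_integral_pushforward _ _ (measurableTypeR R) (measurableTypeR R) R phi mphi' mu
    setT (fun x => `|(f x)%:E|)%E.
  rewrite preimage_setT => /(_ measurableT) <-//.
  - by apply: eq_measure_integral => A mA _; exact/esym/pphi.
  - by apply: measurableT_comp => //; exact/measurable_EFinP.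
split=> //.
have := @integral_pushforward _ _ (measurableTypeR R) (measurableTypeR R) R phi mphi' mu setT (EFin \o f).
rewrite preimage_setT => h.
rewrite /Rintegral; congr fine; rewrite -[LHS]h//; last exact/measurable_EFinP.
by apply: eq_measure_integral => A mA _; exact: pphi.
Qed.

Lemma Rintegral_fold (f : R -> R) : mu.-integrable setT (EFin \o f) ->
  \int[mu]_x f x = \int[mu]_(x in D) f x + \int[mu]_(x in D) f (- x).
Proof.
move=> iF.
have mo : measurable_fun setT (-%R : R -> R) by exact: oppr_measurable.
have [iN _] := Rintegral_comp_preserving mo (@lebesgue_measureN R) iF.
have iNle : mu.-integrable setT (EFin \o (f \_ `]-oo, 0])).
  rewrite -restrict_EFin.
  apply: (@integrable_mkcond _ _ _ mu _ (EFin \o f) (measurable_itv `]-oo, 0])).1.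
  exact: integrableS iF.
have [_ e] := Rintegral_comp_preserving mo (@lebesgue_measureN R) iNle.
have eT : [set: R] = D `|` `]-oo, 0].
  by apply/seteqP; split=> x //= _; rewrite !in_itv/= andbT; case: ltP => _; [left|right].
rewrite [in LHS]eT Rintegral_setU//; last 2 first.
- by rewrite -eT.
- by rewrite disj_set2E; apply/eqP; rewrite -subset0 => x []/= /[!in_itv]/=; rewrite andbT ltNge => /negP.
congr (_ + _).
rewrite Rintegral_mkcond -e.
transitivity (\int[mu]_(x in `[0, +oo[) f (- x)).
  rewrite [RHS]Rintegral_mkcond; apply: eq_Rintegral => x _; rewrite !patchE.
  have -> : ((- x) \in `]-oo, 0]%classic) = (x \in `[0, +oo[%classic); last by [].
  by rewrite !mem_setE !in_itv/= andbT oppr_le0.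
rewrite -Rintegral_itv_obnd_cbnd//.
exact: integrableS iN.
Qed.

End HalfPlanes.

(** * The integral over the plane *)

Section Plane.
Variable R : realType.
Local Notation mu := (@lebesgue_measure R).
Local Notation D := (`]0%R, +oo[%classic : set R).
Local Notation P := (@lebesgue_measure R \x @lebesgue_measure R)%E.

Lemma integralT_gauss_scaled (k : R) : 0 < k ->
  (\int[mu]_x (expR (- (k * x ^+ 2)))%:E = (Num.sqrt (pi / k))%:E)%E.
Proof.
move=> k0; rewrite ge0_symfun_integralT.
- rewrite (_ : [set x : R | 0 <= x] = `[0, +oo[%classic); last first.
    by apply/seteqP; split => x/=; rewrite in_itv/= andbT.
  rewrite -integral_itv_obnd_cbnd; last by apply/measurable_EFinP; mfun.
  by rewrite integral_gauss0y// -EFinM; congr (_%:E); field.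
- by move=> x; exact: expR_ge0.
- exact: continuous_comp_gauss.
- by move=> x /=; rewrite sqrrN.
Qed.

(* The real part of e^{i beta} times the regularized integrand of E (z^2, 0, z). *)
Definition planeF (beta z e x y : R) : R :=
  expR (- (e * (x ^+ 2 + y ^+ 2))) *
  cos (beta - z ^+ 2 * x - z * (x ^+ 2 + y ^+ 2) + x ^+ 3 - 3 * x * y ^+ 2).

Lemma measurable_planeF beta z e :
  measurable_fun setT (fun p : R * R => planeF beta z e p.1 p.2).
Proof. by rewrite /planeF; mfun. Qed.

Lemma planeF_bound beta z e x y :
  `|planeF beta z e x y| <= expR (- (e * x ^+ 2)) * expR (- (e * y ^+ 2)).
Proof.
rewrite (le_trans (norm_mul_cos_le _ _))// ger0_norm ?expR_ge0// -expRD.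
by rewrite -opprD -mulrDr.
Qed.

Lemma gauss_integrableT (k : R) : 0 < k ->
  mu.-integrable setT (EFin \o (fun x => expR (- (k * x ^+ 2)))).
Proof.
move=> k0; apply/ge0_integrableP; first by mfun.
  by move=> x _; exact: expR_ge0.
by rewrite integralT_gauss_scaled// ltry.
Qed.

Lemma planeF_integrable beta z e : 0 < e ->
  P.-integrable setT (EFin \o (fun p : R * R => planeF beta z e p.1 p.2)).
Proof.
move=> e0.
apply: (@integrable_dominated _ _ _ P setT _
  (fun p : R * R => expR (- (e * p.1 ^+ 2)) * expR (- (e * p.2 ^+ 2)))) => //.
- exact: measurable_planeF.
- by move=> p _; exact: planeF_bound.
apply/integrable12ltyP; first by apply/measurable_EFinP; mfun.
have -> : (\int[mu]_x \int[mu]_y `|(EFin \o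
    (fun p : R * R => (expR (- (e * p.1 ^+ 2)) * expR (- (e * p.2 ^+ 2)))%R)) (x, y)| =
    \int[mu]_x ((Num.sqrt (pi / e))%:E * (expR (- (e * x ^+ 2)))%:E))%E.
  apply: eq_integral => x _; rewrite muleC -integralT_gauss_scaled// -ge0_integralZl_EFin//.
  - by apply: eq_integral => y _ /=; rewrite ger0_norm ?mulr_ge0 ?expR_ge0.
  - by apply/measurable_EFinP; mfun.
rewrite ge0_integralZl_EFin//.
- by rewrite integralT_gauss_scaled// -EFinM ltry.
- by apply/measurable_EFinP; mfun.
Qed.

(** The factor 2 is the evenness in the second variable; the two summands are the sides u > 0 and u
    < 0 of the line u = 0 after the shift by z/3. *)
Lemma planeF_fold (beta z e : R) : 0 < e ->
  \int[P]_p planeF beta z e p.1 p.2 =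
  2 * (\int[mu]_(s in D) \int[mu]_(r in D) halfPsi (beta + 5 * z ^+ 3 / 27) z e r s +
       \int[mu]_(s in D) \int[mu]_(r in D) halfPsi (- (beta + 5 * z ^+ 3 / 27)) (- z) e r s).
Proof.
move=> e0; have iP := planeF_integrable beta z e0.
pose g x := \int[mu]_y planeF beta z e x y.
have iS x : mu.-integrable setT (EFin \o planeF beta z e x).
  apply: (@integrable_dominated _ _ _ mu setT _
    (fun y : R => expR (- (e * x ^+ 2)) * expR (- (e * y ^+ 2)))) => //.
  - by rewrite /planeF; mfun.
  - by move=> y _; exact: planeF_bound.
  - by apply: integrable_scale => //; exact: gauss_integrableT.
have gE x : (g x)%:E = (\int[mu]_y (planeF beta z e x y)%:E)%E.
  by rewrite /g fineK//; apply: integrable_fin_num => //; exact: iS.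
have ig : mu.-integrable setT (EFin \o g).
  have := integrable_fubini_F iP; congr (_.-integrable _ _).
  by apply/funext => x; rewrite /= gE.
have -> : \int[P]_p planeF beta z e p.1 p.2 = \int[mu]_x g x.
  rewrite /Rintegral -(integral12_prod_meas1 iP); congr fine.
  by apply: eq_integral => x _; rewrite /= gE.
have g2 x : g x = 2 * \int[mu]_(y in D) planeF beta z e x y.
  rewrite /g Rintegral_fold// mulr_natl mulr2n; congr (_ + _).
  by apply: eq_Rintegral => y _; rewrite /planeF sqrrN.
have mshift : measurable_fun setT (fun x : R => x + - (z / 3)) by mfun.
have [ig' <-] := Rintegral_comp_preserving mshift (lebesgue_measure_shift (- (z / 3))) ig.
rewrite (Rintegral_fold ig').
have inner (b w x u : R) :
    (forall h, planeF beta z e x h = expR (- (e * (u - w / 3) ^+ 2)) *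
      (expR (- (e * h ^+ 2)) * cos (b + u ^+ 3 - 2 * w * u ^+ 2 - 3 * u * h ^+ 2))) ->
  expR (- (e * (u - w / 3) ^+ 2)) * \int[mu]_(h in D)
      (expR (- (e * h ^+ 2)) * cos (b + u ^+ 3 - 2 * w * u ^+ 2 - 3 * u * h ^+ 2)) =
  2^-1 * g x.
  move=> hE; rewrite g2 [RHS]mulrA mulVf// mul1r -RintegralZl//.
    by apply: eq_Rintegral => h _; rewrite hE.
  apply: (@integrable_dominated _ _ _ mu D _ (fun y : R => expR (- (e * y ^+ 2)))) => //.
  - by mfun.
  - by move=> y _; rewrite (le_trans (norm_mul_cos_le _ _))// ger0_norm ?expR_ge0.
  - by apply: integrableS (gauss_integrableT e0).
have half (G : R -> R) : mu.-integrable setT (EFin \o G) ->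
    \int[mu]_(x in D) G x = 2 * \int[mu]_(x in D) (2^-1 * G x).
  move=> iG; rewrite RintegralZl//; first by rewrite mulrA divff// mul1r.
  exact: integrableS iG.
have mo : measurable_fun setT (-%R : R -> R) by exact: oppr_measurable.
have [iN _] := Rintegral_comp_preserving mo (@lebesgue_measureN R) ig'.
clearbody g.
rewrite -!half_rotate// mulrDr (half _ ig') (half _ iN).
congr +%R; congr *%R; apply: eq_Rintegral => u _; apply/esym.
- apply: (inner (beta + 5 * z ^+ 3 / 27) z (u + - (z / 3)) u) => h.
  rewrite /planeF mulrA -expRD.
  by congr (expR _ * cos _); field.
(* At - u the argument of the cosine is the opposite of the one that [half_rotate] expects for -
   beta - 5 z^3 / 27 and - z. *)
- apply: (inner (- (beta + 5 * z ^+ 3 / 27)) (- z) (- u + - (z / 3)) u) => h.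
  rewrite /planeF mulrA -expRD -[cos (_ - 3 * u * _)]cosN.
  by congr (expR _ * cos _); field.
Qed.

Definition sexticJ (beta z : R) : R :=
  \int[mu]_(t in D) (expR (2 * z * cos (pi / 6) * t ^+ 4 - t ^+ 6) *
    cos (beta - pi / 6 - z * t ^+ 4)).

Lemma planeF_cvg (beta z : R) :
  \int[P]_p planeF beta z e p.1 p.2 @[e --> 0^'+] -->
  2 * Num.sqrt (pi / 3) * (sexticJ (beta + 5 * z ^+ 3 / 27) z +
    sexticJ (- (beta + 5 * z ^+ 3 / 27)) (- z)).
Proof.
have hJ b w : \int[mu]_(s in D) \int[mu]_(r in D) halfPsi b w e r s @[e --> 0^'+] -->
    Num.sqrt (pi / 3) * sexticJ b w.
  by rewrite /sexticJ -half_limit; exact: half_cvg.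
have h := @cvgMl_tmp _ _ _ _ _ (2 : R) _
  (cvgD (hJ (beta + 5 * z ^+ 3 / 27) z) (hJ (- (beta + 5 * z ^+ 3 / 27)) (- z))).
rewrite -mulrA mulrDr; have F0 : Filter (0 : R)^'+ by exact: _.
have {}h := h F0 F0; move: h.
apply: cvg_trans; apply: near_eq_cvg; near=> e.
by rewrite planeF_fold.
Unshelve. all: by end_near. Qed.

End Plane.

(** * Moments of exp (- t^6) *)

Section Moments.
Variable R : realType.
Local Notation mu := (@lebesgue_measure R).
Local Notation D := (`]0%R, +oo[%classic : set R).

Instance is_derive_exprn (k : nat) (x : R) :
  is_derive x (1 : R) (fun t : R => t ^+ k) (k%:R * x ^+ k.-1).
Proof.
apply: DeriveDef; first exact: exprn_derivable.
by rewrite exp_derive !scaleE mulr1.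
Qed.

(** This is Gamma ((k + 1) / 6) / 6, kept as a moment so that Gamma itself appears at two values
    only. *)
Definition sexticI (k : nat) : R := \int[mu]_(t in D) (t ^+ k * expR (- t ^+ 6)).

(** The right-hand side lies above the tangent of t^6 at t = 1. *)
Lemma sextic_ge_linear (t : R) : 0 <= t -> 6 * t - 5 <= t ^+ 6.
Proof.
move=> t0; rewrite -subr_ge0.
have -> : t ^+ 6 - (6 * t - 5) = (t - 1) ^+ 2 * (t ^+ 4 + 2 * t ^+ 3 + 3 * t ^+ 2 + 4 * t + 5) by ring.
rewrite mulr_ge0 ?sqr_ge0//; have := exprn_ge0 4 t0; have := exprn_ge0 3 t0.
have := exprn_ge0 2 t0; lra.
Qed.

Lemma sexticI_bound (k : nat) (t : R) : 0 <= t ->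
  t ^+ k * expR (- t ^+ 6) <= k`!%:R * expR 5 * expR (- t).
Proof.
move=> t0; apply: (@le_trans _ _ (k`!%:R * expR t * (expR 5 * expR (- t) * expR (- t)))).
  rewrite ler_pM ?exprn_ge0 ?expR_ge0 ?exprn_le_expR// -!expRD ler_expR.
  have := sextic_ge_linear t0; lra.
have -> : k`!%:R * expR t * (expR 5 * expR (- t) * expR (- t)) =
  k`!%:R * expR 5 * expR (- t) * (expR t * expR (- t)) by ring.
by rewrite expRxMexpNx_1 mulr1.
Qed.

Lemma sexticI_integrable (k : nat) :
  mu.-integrable D (EFin \o (fun t : R => t ^+ k * expR (- t ^+ 6))).
Proof.
apply: (@integrable_dominated _ _ _ mu D _ (fun t : R => k`!%:R * expR 5 * expR (- t))) => //.
- by mfun.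
- move=> t; rewrite /= in_itv/= andbT => t0; rewrite ger0_norm; first exact/sexticI_bound/ltW.
  by rewrite mulr_ge0 ?expR_ge0// exprn_ge0// ltW.
by apply: integrable_scale => //; exact: expRN_integrable.
Qed.

Lemma sexticI_cvg0 (k : nat) : (n.+1%:R : R) ^+ k * expR (- (n.+1%:R) ^+ 6) @[n --> \oo] --> (0 : R).
Proof.
apply: (@squeeze_cvgr _ _ _ _ (cst 0) (fun n => k`!%:R * expR 5 * expR (- n.+1%:R))).
- by near=> n; rewrite sexticI_bound// andbT mulr_ge0 ?expR_ge0// exprn_ge0.
- exact: cvg_cst.
- by rewrite -[X in _ --> X](mulr0 (k`!%:R * expR 5)); apply: cvgMl_tmp; exact: cvgn_expRN.
Unshelve. all: by end_near. Qed.

(** The derivative of t^(k + 1) exp (- t^6) has integral 0, since the function vanishes at both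
    ends. *)
Lemma sexticI_rec (k : nat) : sexticI (k + 6) = k.+1%:R / 6 * sexticI k.
Proof.
pose g (t : R) := k.+1%:R * (t ^+ k * expR (- t ^+ 6)) - 6 * (t ^+ (k + 6) * expR (- t ^+ 6)).
have i1 := @integrable_scale R _ _ mu D k.+1%:R _ (measurable_itv _) (sexticI_integrable k).
have i2 := @integrable_scale R _ _ mu D 6 _ (measurable_itv _) (sexticI_integrable (k + 6)).
have h : \int[mu]_(t in D) g t = 0 - (0 : R) ^+ k.+1 * expR (- 0 ^+ 6).
  apply: (@Rintegral0y_derive R (fun t => t ^+ k.+1 * expR (- t ^+ 6))).
  - move=> t; apply: is_derive_eq; rewrite !scaleE /g !exprD !exprS /= ; ring.
  - move=> t; exact: is_derive_continuous.
  - exact: (integrableB _ i1 i2).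
  - exact: sexticI_cvg0.
have e0 : (0 : R) ^+ k.+1 * expR (- 0 ^+ 6) = 0 by rewrite exprS !mul0r.
rewrite e0 subr0 in h.
rewrite /g RintegralB// in h.
rewrite !RintegralZl// in h; try exact: sexticI_integrable.
move/eqP : h; rewrite subr_eq0 => /eqP h.
by rewrite /sexticI; apply: (@mulfI _ (6 : R)) => //; rewrite -h; field.
Qed.

Lemma sexticI_ge0 (k : nat) : 0 <= sexticI k.
Proof.
by apply: Rintegral_ge0 => t; rewrite /= in_itv/= andbT => t0; rewrite mulr_ge0 ?expR_ge0// exprn_ge0// ltW.
Qed.

Lemma is_derive_exp_partial (a : nat -> R) (N : nat) (y : R) :
  is_derive y (1 : R) (fun y => \sum_(i < N.+1) a i * (y ^+ i / i`!%:R))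
    (\sum_(i < N) a i.+1 * (y ^+ i / i`!%:R)).
Proof.
have -> : (fun y => \sum_(i < N.+1) a i * (y ^+ i / i`!%:R)) =
    \sum_(i < N.+1) (fun y => a i * (y ^+ i / i`!%:R)).
  by apply/funext => w; rewrite fct_sumE.
have dt (i : 'I_N.+1) : is_derive y (1 : R) (fun y => a i * (y ^+ i / i`!%:R))
    (a i * (i%:R * y ^+ i.-1 / i`!%:R)).
  by apply: is_derive_eq; rewrite !scaleE; ring.
apply: is_derive_eq; rewrite big_ord_recl /= mul0r mul0r mulr0 add0r.
apply: eq_bigr => i _; rewrite /bump /= add1n factS natrM; congr (_ * _); field.
by rewrite nat1r !pnatr_eq0 -lt0n fact_gt0.
Qed.

Lemma ge0_of_derive (f g : R -> R) : (forall y, is_derive y (1 : R) f (g y)) ->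
  f 0 = 0 -> (forall y, 0 < y -> 0 <= g y) -> forall y, 0 <= y -> 0 <= f y.
Proof.
move=> df f0 g0 y y0; rewrite -f0; apply: (@ger0_derive1_ndecry _ f 0) => //.
- by move=> x; rewrite in_itv/= andbT => x0; rewrite derive1E derive_val; exact: g0.
- by apply: continuous_subspaceT => x; exact: is_derive_continuous.
Qed.

(** * Expansion in powers of z under the integral *)

Section exponential_series.
Variable z : R.

(** The real part of e^{i g} exp (2 z e^{- i pi/6} y), where 2 sin (pi/6) = 1. [cosexp_sum] is its
    truncated power series, and [exp_rem] the remainder of the majorizing series of exp (2 |z|
    y). *)
Definition cosexp (g y : R) : R := expR (2 * z * cos (pi / 6) * y) * cos (g - z * y).
Definition cosexp_sum (g : R) (N : nat) (y : R) : R :=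
  \sum_(n < N) (2 * z) ^+ n * cos (g - n%:R * (pi / 6)) * (y ^+ n / n`!%:R).
Definition exp_rem (N : nat) (y : R) : R :=
  expR (2 * `|z| * y) - \sum_(n < N) (2 * `|z|) ^+ n * (y ^+ n / n`!%:R).

(* Both sides vanish at 0 and the inequality between the derivatives is the
   induction hypothesis, with the phase shifted by pi / 6. *)
Lemma cosexp_rem_le (N : nat) (g y : R) : 0 <= y ->
  `|cosexp g y - cosexp_sum g N y| <= exp_rem N y.
Proof.
elim: N g y => [|N IH] g y y0.
  rewrite /cosexp_sum /exp_rem !big_ord0 !subr0 /cosexp (le_trans (norm_mul_cos_le _ _))//.
  rewrite ger0_norm ?expR_ge0// ler_expR ler_wpM2r//.
  have /andP[b3 b1] := cos_pi6_bounds R.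
  have := ler_norm z; have := normr_ge0 z; nra.
have dF x : is_derive x (1 : R) (cosexp g) (2 * z * cosexp (g - pi / 6) x).
  rewrite /cosexp; apply: is_derive_eq; rewrite !scaleE.
  have -> : g - pi / 6 - z * x = (g - z * x) - pi / 6 by ring.
  by rewrite (cosB (g - z * x)) sin_pi6; field.
have dS x : is_derive x (1 : R) (cosexp_sum g N.+1) (2 * z * cosexp_sum (g - pi / 6) N x).
  rewrite /cosexp_sum; apply: is_derive_eq.
    exact: (is_derive_exp_partial (fun n => (2 * z) ^+ n * cos (g - n%:R * (pi / 6)))).
  rewrite big_distrr /=; apply: eq_bigr => i _; rewrite exprS !mulrA.
  congr (_ * cos _ * _ / _); rewrite -natr1; ring.
have dG x : is_derive x (1 : R) (exp_rem N.+1) (2 * `|z| * exp_rem N x).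
  rewrite /exp_rem; apply: is_derive_eq.
    apply: is_deriveB.
    exact: (is_derive_exp_partial (fun n => (2 * `|z|) ^+ n)).
  rewrite mulrBr big_distrr /= !scaleE; congr (_ - _); first by ring.
  by apply: eq_bigr => i _; rewrite exprS; ring.
have IHz x : 0 < x ->
    `|2 * z * (cosexp (g - pi / 6) x - cosexp_sum (g - pi / 6) N x)| <= 2 * `|z| * exp_rem N x.
  by move=> x0; rewrite normrM normrM ger0_norm// ler_wpM2l ?mulr_ge0// IH// ltW.
have F0 : cosexp g 0 - cosexp_sum g N.+1 0 = 0.
  rewrite /cosexp /cosexp_sum big_ord_recl big1 => [|i _]; last by rewrite /= expr0n /= mul0r mulr0.
  by rewrite !mulr0 expR0 subr0 /= !expr0 fact0 mul0r subr0 invr1 !mulr1 !mul1r addr0 subrr.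
have G0 : exp_rem N.+1 0 = 0.
  rewrite /exp_rem big_ord_recl big1 => [|i _]; last by rewrite /= expr0n /= mul0r mulr0.
  by rewrite !mulr0 expR0 /= !expr0 fact0 invr1 !mulr1 addr0 subrr.
rewrite ler_norml; apply/andP; split; rewrite -subr_ge0.
- rewrite opprK; apply: (@ge0_of_derive (fun y => cosexp g y - cosexp_sum g N.+1 y + exp_rem N.+1 y)
    (fun y => 2 * z * cosexp (g - pi / 6) y - 2 * z * cosexp_sum (g - pi / 6) N y +
      2 * `|z| * exp_rem N y)) => //.
  + by rewrite F0 G0 addr0.
  + move=> x x0; have := IHz x x0; rewrite ler_norml => /andP[]; lra.
- apply: (@ge0_of_derive (fun y => exp_rem N.+1 y - (cosexp g y - cosexp_sum g N.+1 y))
    (fun y => 2 * `|z| * exp_rem N y -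
      (2 * z * cosexp (g - pi / 6) y - 2 * z * cosexp_sum (g - pi / 6) N y))) => //.
  + by rewrite F0 G0 subr0.
  + move=> x x0; have := IHz x x0; rewrite ler_norml => /andP[]; lra.
Qed.

Lemma exp_rem_cvg0 (y : R) : exp_rem N y @[N --> \oo] --> (0 : R).
Proof.
have h : series (exp_coeff (2 * `|z| * y)) @ \oo --> expR (2 * `|z| * y).
  exact: is_cvg_series_exp_coeff.
rewrite -[X in _ --> X](subrr (expR (2 * `|z| * y))).
rewrite /exp_rem; apply: cvgB; first exact: cvg_cst.
apply: cvg_trans h; apply: near_eq_cvg; near=> N.
rewrite /series /= big_mkord; apply: eq_bigr => i _.
by rewrite exp_coeffE exprMn; ring.
Unshelve. all: by end_near. Qed.

Definition sextic_coef (n : nat) : R := sexticI (4 * n) * ((2 * z) ^+ n / n`!%:R).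
Definition sextic_major : R := \int[mu]_(t in D) expR (2 * `|z| * t ^+ 4 - t ^+ 6).

Lemma sextic_major_integrable :
  mu.-integrable D (EFin \o (fun t : R => expR (2 * `|z| * t ^+ 4 - t ^+ 6))).
Proof.
rewrite (_ : (fun t : R => _) = (fun t => expR (2 * `|z| * t ^+ 4 - t ^+ 6) * cos (cst 0 t))); last first.
  by apply/funext => t; rewrite cos0 mulr1.
apply: (@expR_cos_integrable R _ _ (2 * `|z| * (2 * `|z| + 1) ^+ 2 + (2 * `|z| + 1) + 1)) => [t t0||];
  [|by mfun|exact: measurable_cst].
have := @cubic_bound R (2 * `|z|) (t ^+ 2).
rewrite mulr_ge0// -!exprM => /(_ isT (sqr_ge0 _)).
have := sqr_ge0 (t - 1); rewrite sqrrB1; lra.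
Qed.

Lemma sextic_sum_integrable (a : nat -> R) (N : nat) : mu.-integrable D (EFin \o
  (fun t : R => expR (- t ^+ 6) * \sum_(n < N) a n * ((t ^+ 4) ^+ n / n`!%:R))).
Proof.
elim: N => [|N IH].
  rewrite (_ : _ \o _ = cst 0%E); first exact: integrable0.
  by apply/funext => t /=; rewrite big_ord0 mulr0.
rewrite (_ : _ \o _ = (fun t : R => (expR (- t ^+ 6) * \sum_(n < N) a n * ((t ^+ 4) ^+ n / n`!%:R))%:E
   + (a N / N`!%:R * (t ^+ (4 * N) * expR (- t ^+ 6)))%:E)%E); last first.
  apply/funext => t /=; rewrite big_ord_recr /= -EFinD mulrDr; congr (_ + _)%:E.
  by rewrite exprM; ring.
by apply: integrableD => //; apply: integrable_scale => //; exact: sexticI_integrable.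
Qed.

Lemma Rintegral_sextic_sum (a : nat -> R) (N : nat) :
  \int[mu]_(t in D) (expR (- t ^+ 6) * \sum_(n < N) a n * ((t ^+ 4) ^+ n / n`!%:R)) =
  \sum_(n < N) sexticI (4 * n) * (a n / n`!%:R).
Proof.
have iS := sextic_sum_integrable a.
elim: N => [|N IH].
  rewrite big_ord0; under eq_Rintegral do rewrite big_ord0 mulr0.
  by rewrite Rintegral_cst// mul0r.
rewrite big_ord_recr /= -IH.
have <- : \int[mu]_(t in D) (a N / N`!%:R * (t ^+ (4 * N) * expR (- t ^+ 6))) =
    sexticI (4 * N) * (a N / N`!%:R).
  by rewrite RintegralZl//; [rewrite mulrC|exact: sexticI_integrable].
rewrite -RintegralD//; last by apply: integrable_scale => //; exact: sexticI_integrable.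
apply: eq_Rintegral => t _; rewrite big_ord_recr /= mulrDr; congr (_ + _).
by rewrite exprM; ring.
Qed.

Lemma exp_rem_ge0 (N : nat) (y : R) : 0 <= y -> 0 <= exp_rem N y.
Proof. by move=> /(cosexp_rem_le N 0); apply: le_trans. Qed.

(** The left side is the integral of exp (- t^6) times a partial sum of exp (2 |z| t^4), and such a
    sum lies below the exponential. The bound is independent of N, so the subseries over residue
    classes mod 3 converge absolutely. *)
Lemma sextic_coef_summable (N : nat) : \sum_(n < N) `|sextic_coef n| <= sextic_major.
Proof.
have -> : \sum_(n < N) `|sextic_coef n| =
    \int[mu]_(t in D) (expR (- t ^+ 6) * \sum_(n < N) (2 * `|z|) ^+ n * ((t ^+ 4) ^+ n / n`!%:R)).
  rewrite Rintegral_sextic_sum; apply: eq_bigr => n _.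
  rewrite /sextic_coef normrM (ger0_norm (sexticI_ge0 _)) normrM normrX normrM.
  by rewrite (ger0_norm (ler0n _ 2)) [X in _ * (_ * X) = _]ger0_norm.
apply: le_Rintegral => //.
- exact: sextic_sum_integrable.
- exact: sextic_major_integrable.
- move=> t; rewrite /= in_itv/= andbT => t0.
  rewrite addrC expRD ler_wpM2l ?expR_ge0//.
  by have := exp_rem_ge0 N (exprn_ge0 4 (ltW t0)); rewrite /exp_rem subr_ge0.
Qed.

(** Dominated convergence, with [g + pi / 6] offsetting the phase built into [sexticJ]. The majorant
    has a factor 2 because a partial sum is [cosexp] minus a remainder, each bounded by exp (2 |z|
    t^4). *)
Lemma sexticJ_series (g : R) :
  \sum_(n < N) sextic_coef n * cos (g - n%:R * (pi / 6)) @[N --> \oo] --> sexticJ (g + pi / 6) z.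
Proof.
have -> : (fun N => \sum_(n < N) sextic_coef n * cos (g - n%:R * (pi / 6))) =
    (fun N => \int[mu]_(t in D) (expR (- t ^+ 6) * cosexp_sum g N (t ^+ 4))).
  apply/funext => N; rewrite /cosexp_sum.
  rewrite (Rintegral_sextic_sum (fun n => (2 * z) ^+ n * cos (g - n%:R * (pi / 6)))).
  apply: eq_bigr => n _.
  by rewrite /sextic_coef; ring.
have jE t : expR (2 * z * cos (pi / 6) * t ^+ 4 - t ^+ 6) * cos (g + pi / 6 - pi / 6 - z * t ^+ 4) =
    expR (- t ^+ 6) * cosexp g (t ^+ 4).
  by rewrite /cosexp addrK [_ - t ^+ 6]addrC expRD mulrA.
rewrite /sexticJ; under [X in _ --> X]eq_Rintegral do rewrite jE.
have nR N t : 0 < t -> `|cosexp g (t ^+ 4) - cosexp_sum g N (t ^+ 4)| <= exp_rem N (t ^+ 4).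
  by move=> t0; apply: cosexp_rem_le; rewrite exprn_ge0// ltW.
apply: (@dominated_cvg_Rintegral _ _ _ mu D _ _ (fun t : R => 2 * expR (2 * `|z| * t ^+ 4 - t ^+ 6))) => //.
- move=> N; apply/measurable_EFinP; apply: (measurable_int mu).
  exact: (sextic_sum_integrable (fun n => (2 * z) ^+ n * cos (g - n%:R * (pi / 6))) N).
- by rewrite /cosexp; mfun.
- move=> t; rewrite /= in_itv/= andbT => t0; apply: cvgMl_tmp.
  apply/cvgrPdist_lt => e e0.
  have := exp_rem_cvg0 (t ^+ 4) => /cvgr_lt => /(_ _ e0); apply: filterS => N hN.
  exact: le_lt_trans (nR N t t0) hN.
- by apply: integrable_scale => //; exact: sextic_major_integrable.
- move=> N t; rewrite /= in_itv/= andbT => t0.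
  rewrite normrM ger0_norm ?expR_ge0// [2 * `|z| * _ - _]addrC expRD mulrCA ler_wpM2l ?expR_ge0//.
  have h1 := nR N t t0.
  have h0 := cosexp_rem_le 0 g (exprn_ge0 4 (ltW t0)).
  rewrite /cosexp_sum /exp_rem !big_ord0 !subr0 in h0.
  have h2 : exp_rem N (t ^+ 4) <= expR (2 * `|z| * t ^+ 4).
    rewrite /exp_rem gerBl sumr_ge0// => n _.
    by rewrite mulr_ge0 ?exprn_ge0 ?mulr_ge0// ?invr_ge0// exprn_ge0// exprn_ge0// ltW.
  move: h1 h0 h2; set A := cosexp _ _; set B := cosexp_sum _ _ _; move=> h1 h0 h2.
  have -> : B = A - (A - B) by ring.
  by rewrite (le_trans (ler_normB _ _))//; lra.
Qed.
End exponential_series.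

(** * Gamma values and the product of two moments *)

Let dF6 (x : R) : is_derive x (1 : R) (fun t : R => t ^+ 6) (6 * x ^+ 5).
Proof. by apply: is_derive_eq. Qed.
Let cf6 : continuous (fun x : R => 6 * x ^+ 5).
Proof. by move=> x; exact: is_derive_continuous. Qed.
Let F06 : (0 : R) ^+ 6 = 0. Proof. by rewrite expr0n. Qed.
Let incF6 : {in `[(0 : R), +oo[ &, {homo (fun t : R => t ^+ 6) : x y / x < y}}.
Proof. by move=> x y; rewrite !in_itv/= !andbT => x0 y0 xy; rewrite ltrXn2r. Qed.
Let Fy6 : (n.+1%:R : R) ^+ 6 @[n --> \oo] --> +oo.
Proof.
apply/cvgryPge => A; have /cvgryPge/(_ A) := @cvgn_natS R; apply: filterS => n /le_trans; apply.
by rewrite -[leLHS]expr1 ler_weXn2l// ler1n.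
Qed.

(** The substitution t = x^6; the hypothesis says k = 6 s - 1 in terms of powers. *)
Let Gamma_subst (s : R) (k : nat) :
  (forall x, 0 < x -> (x ^+ 6) `^ (s - 1) * x ^+ 5 = x ^+ k) ->
  Gamma s = 6 * sexticI k.
Proof.
move=> hx.
have e : (\int[mu]_(t in D) (t `^ (s - 1) * expR (- t))%:E =
    \int[mu]_(x in D) (6%:E * (x ^+ k * expR (- x ^+ 6))%:E))%E.
  rewrite (ge0_integral_substitution0y dF6 cf6 F06 incF6 Fy6).
  - apply: eq_integral => x; rewrite inE/= in_itv/= andbT => x0.
    by rewrite -EFinM -(hx _ x0); congr (_%:E); ring.
  - move=> x; rewrite inE/= in_itv/= andbT => x0.
    have dp := is_derive1_powR (s - 1) x0.
    have cx : {for x, continuous (fun t : R => expR (- t))} by exact: is_derive_continuous.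
    exact: (cvgM (is_derive_continuous dp) cx).
  - by move=> x x0; rewrite mulr_ge0 ?powR_ge0 ?expR_ge0.
rewrite /Gamma {1}/Rintegral e /sexticI -RintegralZl//; exact: sexticI_integrable.
Qed.

Let powR6 (x r : R) : 0 < x -> (x ^+ 6) `^ r = x `^ (6 * r).
Proof. by move=> x0; rewrite -powR_mulrn ?ltW// -powRrM. Qed.

Lemma Gamma_7_6 : Gamma (7 / 6 : R) = sexticI 0.
Proof.
rewrite (@Gamma_subst _ 6); last first.
  move=> x x0; rewrite powR6// (_ : 6 * (7 / 6 - 1) = 1); last by field.
  by rewrite powRr1 ?ltW// -exprS.
by rewrite (sexticI_rec 0); field.
Qed.

Lemma Gamma_5_6 : Gamma (5 / 6 : R) = 6 * sexticI 4.
Proof.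
apply: Gamma_subst => x x0; rewrite powR6// (_ : 6 * (5 / 6 - 1) = -1); last by field.
by rewrite powR_inv1 ?ltW// exprS mulrA mulVf ?mul1r// gt_eqF.
Qed.

Let integral_y5 (k : R) : 1 <= k ->
  (\int[mu]_(y in D) (y ^+ 5 * expR (- (k * y ^+ 6)))%:E = ((6 * k)^-1)%:E)%E.
Proof.
move=> k1; have k0 : 0 < k by rewrite (lt_le_trans _ k1).
have iY : mu.-integrable D (EFin \o (fun y : R => y ^+ 5 * expR (- (k * y ^+ 6)))).
  apply: (@integrable_dominated _ _ _ mu D _ (fun t : R => t ^+ 5 * expR (- t ^+ 6))) => //.
  - by mfun.
  - move=> y; rewrite /= in_itv/= andbT => y0.
    rewrite ger0_norm ?mulr_ge0 ?expR_ge0 ?exprn_ge0 ?(ltW y0)//.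
    rewrite ler_wpM2l ?exprn_ge0 ?(ltW y0)// ler_expR lerN2 ler_peMl//.
    by rewrite exprn_ge0// ltW.
  - exact: sexticI_integrable.
have h : \int[mu]_(y in D) (y ^+ 5 * expR (- (k * y ^+ 6))) =
    0 - - (6 * k)^-1 * expR (- (k * 0 ^+ 6)).
  apply: (@Rintegral0y_derive R (fun y => - (6 * k)^-1 * expR (- (k * y ^+ 6)))) => //.
  - by move=> y; apply: is_derive_eq; rewrite !scaleE; field; rewrite gt_eqF.
  - by move=> y; exact: is_derive_continuous.
  rewrite -[X in _ --> X](mulr0 (- (6 * k)^-1)); apply: cvgMl_tmp.
  apply: (@squeeze_cvgr _ _ _ _ (cst 0) (fun n => (n.+1%:R : R) ^+ 0 * expR (- n.+1%:R ^+ 6))).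
  + by near=> n; rewrite expR_ge0/= expr0 mul1r ler_expR lerN2 ler_peMl.
  + exact: cvg_cst.
  + exact: sexticI_cvg0.
rewrite expr0n/= mulr0n !mulr0 oppr0 expR0 mulr1 sub0r opprK in h.
by rewrite -h /Rintegral fineK//; exact: integrable_fin_num.
Unshelve. all: by end_near. Qed.

Let sexticIE (k : nat) : (\int[mu]_(t in D) (t ^+ k * expR (- t ^+ 6))%:E = (sexticI k)%:E)%E.
Proof.
rewrite /sexticI /Rintegral fineK//.
by apply: integrable_fin_num => //; exact: sexticI_integrable.
Qed.

Lemma sexticI_scale (k : nat) (y : R) : 0 < y ->
  (\int[mu]_(v in D) (y ^+ k.+1 * v ^+ k * expR (- (y * v) ^+ 6))%:E = (sexticI k)%:E)%E.
Proof.
move=> y0; rewrite -sexticIE.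
rewrite (@ge0_integral_substitution0y R (fun v => y * v) (fun=> y) _ _ _ _ _
  (fun t => t ^+ k * expR (- t ^+ 6))).
- by apply: eq_integral => v _; congr (_%:E); rewrite exprS [(y * v) ^+ k]exprMn; ring.
- by move=> x; apply: is_derive_eq; rewrite !scaleE mulr1.
- by move=> x; exact: cvg_cst.
- by rewrite mulr0.
- by move=> x w _ _ xw; rewrite ltr_pM2l.
- apply: (cvg_comp (fun n => n.+1%:R) (fun x => y * x) (@cvgn_natS R)).
  by apply: gt0_cvgMry => //; exact: cvg_id.
- by move=> x _; exact: is_derive_continuous.
- by move=> x x0; rewrite mulr_ge0 ?expR_ge0// exprn_ge0// ltW.
Qed.

(* Substituting x = y v in the inner integral of the product and integrating first in y. *)
Lemma sexticI_prod (a b : nat) : (a + b = 4)%N ->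
  ((sexticI a * sexticI b)%:E = \int[mu]_(v in D) (v ^+ a * (6 * (1 + v ^+ 6))^-1)%:E)%E.
Proof.
move=> ab.
pose f (p : R * R) : \bar R := (p.1 ^+ 5 * p.2 ^+ a * expR (- ((1 + p.2 ^+ 6) * p.1 ^+ 6)))%:E.
have e1 : ((sexticI a * sexticI b)%:E = \int[mu]_(y in D) \int[mu]_(v in D) f (y, v))%E.
  rewrite EFinM -[(sexticI b)%:E]sexticIE -ge0_integralZl_EFin//.
  - apply: eq_integral => y; rewrite inE/= in_itv/= andbT => y0.
    rewrite muleC -(sexticI_scale a y0) -ge0_integralZl_EFin//.
    + apply: eq_integral => v _; rewrite -EFinM /f /=; congr (_%:E).
      (* Here [a + b = 4] enters: it produces exactly the power y^5 for which the integral in y is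
         elementary. *)
      have -> : y ^+ 5 = y ^+ b * y ^+ a.+1 by rewrite -exprD addnS addnC ab.
      rewrite mulrDl mul1r opprD expRD [(y * v) ^+ 6]exprMn [v ^+ 6 * _]mulrC; ring.
    + by move=> v; rewrite /= in_itv/= andbT => v0; rewrite lee_fin !mulr_ge0 ?expR_ge0 ?exprn_ge0 ?ltW.
    + by apply/measurable_EFinP; mfun.
    + by rewrite mulr_ge0 ?expR_ge0 ?exprn_ge0 ?ltW.
  - by move=> y; rewrite /= in_itv/= andbT => y0; rewrite lee_fin mulr_ge0 ?expR_ge0 ?exprn_ge0 ?ltW.
  - by apply/measurable_EFinP; mfun.
  - exact: sexticI_ge0.
have f0 p : (0 <= (f \_ (D `*` D)) p)%E.
  rewrite patchE; case: ifPn => //; rewrite inE /= !in_itv/= !andbT => -[p1 p2].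
  by rewrite lee_fin !mulr_ge0 ?expR_ge0 ?exprn_ge0 ?ltW.
have mf : measurable_fun setT (f \_ (D `*` D)).
  apply/(measurable_restrictT _ (@measurable_quadrant R)); apply/measurable_EFinP.
  by apply: measurable_funTS; mfun.
have := @fubini_tonelli _ _ _ _ R mu mu (f \_ (D `*` D)) mf f0.
rewrite iterated_integral_quadrant12 iterated_integral_quadrant21 -e1 => ->.
apply: eq_integral => v; rewrite inE/= in_itv/= andbT => v0.
have v1 : 1 <= 1 + v ^+ 6 by rewrite lerDl exprn_ge0// ltW.
rewrite EFinM -(integral_y5 v1) -ge0_integralZl_EFin//.
- by apply: eq_integral => y _; rewrite /f /= -EFinM; congr (_%:E); ring.
- by move=> y; rewrite /= in_itv/= andbT => y0; rewrite lee_fin !mulr_ge0 ?expR_ge0 ?exprn_ge0 ?ltW.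
- by apply/measurable_EFinP; mfun.
- by rewrite exprn_ge0// ltW.
Qed.

(** This is Gamma (1/6) Gamma (5/6) = 2 pi. Adding the two orders of the product symmetrizes the
    integrand to (1 + v^4) / (6 (1 + v^6)), and (1 + v^4) / (1 + v^6) = 1 / (1 + v^2) + v^2 / (1 +
    v^6) is the derivative of atan v + atan (v^3) / 3. *)
Lemma sexticI_reflection : sexticI 0 * sexticI 4 = pi / 18.
Proof.
pose g (v : R) := 6^-1 * ((1 + v ^+ 2)^-1 + v ^+ 2 * (1 + v ^+ 6)^-1).
have p2 (v : R) : 0 < 1 + v ^+ 2 by have := sqr_ge0 v; lra.
have p6 (v : R) : 0 < 1 + v ^+ 6 by have := sqr_ge0 (v ^+ 3); rewrite -exprM; lra.
have dg v : is_derive v (1 : R) (fun v => 6^-1 * (atan v + 3^-1 * atan (v ^+ 3))) (g v).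
  apply: is_derive_eq; rewrite !scaleE /g -exprM; field.
  by rewrite !gt_eqF.
have cg : continuous g.
  move=> v; rewrite /g; apply: cvgMl_tmp; apply: cvgD.
    by apply: cvgV; [rewrite gt_eqF|apply: cvgD; [exact: cvg_cst|exact: exprn_continuous]].
  apply: cvgM; first exact: exprn_continuous.
  by apply: cvgV; [rewrite gt_eqF|apply: cvgD; [exact: cvg_cst|exact: exprn_continuous]].
have g0 v : 0 <= g v.
  have q2 : 0 <= (1 + v ^+ 2)^-1 by rewrite invr_ge0 ltW.
  have q6 : 0 <= (1 + v ^+ 6)^-1 by rewrite invr_ge0 ltW.
  by rewrite /g mulr_ge0 ?invr_ge0// addr_ge0// mulr_ge0// sqr_ge0.
have e : ((sexticI 0 * sexticI 4 + sexticI 4 * sexticI 0)%:E = \int[mu]_(v in D) (g v)%:E)%E.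
  rewrite EFinD !sexticI_prod// -ge0_integralD//.
  - apply: eq_integral => v _; rewrite -EFinD; congr (_%:E); rewrite /g.
    have -> : v ^+ 6 = (v ^+ 2) ^+ 3 by rewrite -exprM.
    have -> : v ^+ 4 = (v ^+ 2) ^+ 2 by rewrite -exprM.
    rewrite expr0; field.
    have := p6 v; have := p2 v; rewrite (_ : v ^+ 6 = (v ^+ 2) ^+ 3); last by rewrite -exprM.
    by move=> h2 h6; rewrite !gt_eqF.
  - by move=> v _; rewrite lee_fin mulr_ge0 ?expr0// invr_ge0 mulr_ge0// ltW.
  - apply/measurable_EFinP; apply: measurable_funTS; apply: continuous_measurable_fun => v.
    apply: cvgM; first exact: exprn_continuous.
    apply: cvgV; first by rewrite gt_eqF// mulr_gt0.
    by apply: cvgMl_tmp; apply: cvgD; [exact: cvg_cst|exact: exprn_continuous].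
  - move=> v; rewrite /= in_itv/= andbT => v0.
    by rewrite lee_fin mulr_ge0 ?exprn_ge0 ?(ltW v0)// invr_ge0 mulr_ge0// ltW.
  - apply/measurable_EFinP; apply: measurable_funTS; apply: continuous_measurable_fun => v.
    apply: cvgM; first exact: exprn_continuous.
    apply: cvgV; first by rewrite gt_eqF// mulr_gt0.
    by apply: cvgMl_tmp; apply: cvgD; [exact: cvg_cst|exact: exprn_continuous].
have ig : mu.-integrable D (EFin \o g).
  apply/ge0_integrableP.
  - by apply: measurable_funTS; exact: continuous_measurable_fun.
  - by move=> v _; exact: g0.
  - by rewrite -e ltry.
have h : \int[mu]_(v in D) g v = 6^-1 * (pi / 2 + 3^-1 * (pi / 2)) - 6^-1 * (atan 0 + 3^-1 * atan (0 ^+ 3)).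
  apply: (Rintegral0y_derive dg cg ig).
  apply: cvgMl_tmp; apply: cvgD.
    exact: (cvg_comp (fun n => n.+1%:R : R) (@atan R) (@cvgn_natS R) (@cvgy_atan R)).
  apply: cvgMl_tmp.
  apply: (cvg_comp (fun n => (n.+1%:R : R) ^+ 3) (@atan R) _ (@cvgy_atan R)).
  apply/cvgryPge => A; have /cvgryPge/(_ A) := @cvgn_natS R; apply: filterS => n /le_trans; apply.
  by rewrite -[leLHS]expr1 ler_weXn2l// ler1n.
rewrite expr0n /= mulr0n atan0 mulr0 addr0 mulr0 subr0 in h.
rewrite /Rintegral -e /= in h.
lra.
Qed.

Lemma sexticI0_sexticI4_gt0 : 0 < sexticI 0 /\ 0 < sexticI 4.
Proof.
have h : 0 < sexticI 0 * sexticI 4 by rewrite sexticI_reflection divr_gt0 ?pi_gt0.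
have h0 := sexticI_ge0 0; have h4 := sexticI_ge0 4.
by split; rewrite lt_neqAle ?h0 ?h4 andbT eq_sym; apply: contraTneq h => ->; rewrite ?mul0r ?mulr0 ltxx.
Qed.

End Moments.

(** * The hypergeometric series *)

Section ComplexLimit.
Variable R : realType.

Lemma normc_realC (x : R) : `|x%:C| = `|x|%:C.
Proof. by rewrite normc_def /= expr0n addr0 sqrtr_sqr. Qed.

Lemma normc_le (x y : R) : `|x +i* y| <= (`|x| + `|y|)%:C.
Proof.
have -> : x +i* y = x%:C + 'i%C * y%:C by rewrite [LHS]complexE.
have n1 : `|'i%C : R[i]| = 1 by rewrite normc_def /= expr0n expr1n add0r sqrtr1.
by rewrite (le_trans (ler_normD _ _))// normrM n1 mul1r !normc_realC rmorphD.
Qed.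

Lemma cvg_complex (T : Type) (F : set_system T) (FF : Filter F) (f g : T -> R) (a b : R) :
  f @ F --> a -> g @ F --> b -> (fun t => f t +i* g t : R[i]^o) @ F --> (a +i* b : R[i]^o).
Proof.
move=> /cvgrPdist_le fa /cvgrPdist_le gb; apply/cvgrPdist_le => e; rewrite ltcE /= => /andP[/eqP ei e0].
have e2 : 0 < complex.Re e / 2 by rewrite divr_gt0.
near=> t.
rewrite (_ : _ - _ = (a - f t) +i* (b - g t))//.
apply: le_trans (normc_le _ _) _; rewrite lecE /= ei eqxx /=.
rewrite [leRHS]splitr lerD//; near: t; [exact: fa|exact: gb].
Unshelve. all: by end_near. Qed.

Lemma lim_complex (T : Type) (F : set_system T) (FF : ProperFilter F) (f g : T -> R) (a b : R) :
  f @ F --> a -> g @ F --> b -> lim ((fun t => f t +i* g t : R[i]^o) @ F) = a +i* b.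
Proof. by move=> fa gb; apply/cvg_lim; [exact: norm_hausdorff|exact: cvg_complex]. Qed.

Lemma cvgn_sum_bounded (a b : nat -> R) (C : R) : (forall N, \sum_(n < N) `|a n| <= C) ->
  (forall n, `|b n| <= 1) -> exists l : R, \sum_(n < N) a n * b n @[N --> \oo] --> l.
Proof.
move=> aC b1.
have h : cvgn [normed series (fun n => a n * b n)].
  apply: nondecreasing_is_cvgn; first by apply: nondecreasing_series => n _ _; exact: normr_ge0.
  exists C; move=> _ [N _ <-].
  rewrite [leLHS](_ : _ = \sum_(n < N) `|a n * b n|); last first.
    by rewrite -(big_mkord xpredT (fun n => `|a n * b n|)).
  rewrite (le_trans _ (aC N))// ler_sum// => n _.
  by rewrite normrM ler_piMr.
exists (limn (series (fun n => a n * b n))).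
have := normed_cvg h; rewrite /series/=; under eq_fun do rewrite big_mkord; exact.
Qed.

Lemma expNi (k : nat) :
  (- 'i%C : R[i]) ^+ k = cos (k%:R * (pi / 2)) +i* (- sin (k%:R * (pi / 2))).
Proof.
elim: k => [|k IH]; first by rewrite expr0 mul0r cos0 sin0 oppr0.
have e : k.+1%:R * (pi / 2) = k%:R * (pi / 2) + pi / 2 :> R by rewrite -natr1 mulrDl mul1r.
rewrite exprSr IH e cosD sinD cos_pihalf sin_pihalf !mulr0 !mulr1 sub0r add0r.
by apply/eqP; rewrite eq_complex /=; apply/andP; split; apply/eqP; ring.
Qed.

(** The argument of the series is - i x with x real: x^n stays in this real term, and (- i)^n turns
    into the cosine and sine of n pi/2. *)
Definition hyperTerm (a1 a2 b1 b2 x : R) (n : nat) : R :=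
  pochhammer a1 n * pochhammer a2 n / (pochhammer b1 n * pochhammer b2 n) * (x ^+ n / n`!%:R).

Lemma pochhammerS (K : pzRingType) (a : K) (n : nat) :
  pochhammer a n.+1 = pochhammer a n * (a + n%:R).
Proof. by rewrite /pochhammer big_ord_recr. Qed.

Lemma pochhammerC (a : R) (n : nat) : pochhammer a%:C n = (pochhammer a n)%:C.
Proof.
by rewrite /pochhammer rmorph_prod; apply: eq_bigr => k _; rewrite rmorphD rmorph_nat.
Qed.

Lemma hyperTermS (a1 a2 b1 b2 x : R) (n : nat) :
  hyperTerm a1 a2 b1 b2 x n.+1 = hyperTerm a1 a2 b1 b2 x n *
    ((a1 + n%:R) * (a2 + n%:R) / ((b1 + n%:R) * (b2 + n%:R)) * (x / n.+1%:R)).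
Proof.
rewrite /hyperTerm !pochhammerS exprSr factS natrM !invfM; ring.
Qed.

Lemma hyperTermC (a1 a2 b1 b2 x : R) (n : nat) :
  pochhammer a1%:C n * pochhammer a2%:C n / (pochhammer b1%:C n * pochhammer b2%:C n)
    * ((- 'i%C * x%:C) ^+ n / n`!%:R) = (hyperTerm a1 a2 b1 b2 x n)%:C * (- 'i%C) ^+ n.
Proof.
rewrite /hyperTerm !pochhammerC exprMn !rmorphM !fmorphV/= !rmorphM rmorphXn/= rmorph_nat; ring.
Qed.

Lemma hyper2F2_lim (a1 a2 b1 b2 x la lb : R) :
  \sum_(n < N) hyperTerm a1 a2 b1 b2 x n * cos (n%:R * (pi / 2)) @[N --> \oo] --> la ->
  \sum_(n < N) hyperTerm a1 a2 b1 b2 x n * sin (n%:R * (pi / 2)) @[N --> \oo] --> lb ->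
  hyper2F2 a1%:C a2%:C b1%:C b2%:C (- 'i%C * x%:C) = la -i* lb.
Proof.
move=> ha hb; rewrite /hyper2F2.
transitivity (limn (fun N => (\sum_(n < N) hyperTerm a1 a2 b1 b2 x n * cos (n%:R * (pi / 2))) +i*
  (- \sum_(n < N) hyperTerm a1 a2 b1 b2 x n * sin (n%:R * (pi / 2))) : R[i]^o)); last first.
  exact: lim_complex ha (cvgN hb).
apply: (f_equal (fun h : nat -> R[i]^o => limn h)); apply/funext => N.
rewrite /series/= big_mkord; elim: N => [|N IH]; first by rewrite !big_ord0 oppr0.
rewrite !big_ord_recr/= IH hyperTermC expNi.
by apply/eqP; rewrite eq_complex /=; apply/andP; split; apply/eqP; ring.
Qed.

End ComplexLimit.

Section HypergeometricSums.
Variable R : realType.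
Local Notation P := (@lebesgue_measure R \x @lebesgue_measure R)%E.
Implicit Types (z b : R) (n k N : nat).

Lemma big_ord_mul3 (f : nat -> R) N :
  \sum_(n < 3 * N) f n = \sum_(k < N) (f (3 * k)%N + f (3 * k).+1 + f (3 * k).+2).
Proof.
elim: N => [|N IH]; first by rewrite !big_ord0.
have -> : (3 * N.+1 = (3 * N).+3)%N by rewrite mulnS addnC !addnS addn0.
by rewrite !big_ord_recr/= IH !addrA.
Qed.

(** As 4 (n + 3) = 4 n + 12, the moment recurrence is used twice; this gives the two numerator
    factors. *)
Lemma sextic_coef_step z n : sextic_coef z n.+3 = sextic_coef z n *
  ((4 * n%:R + 1) * (4 * n%:R + 7) / 36 * ((2 * z) ^+ 3 / ((n%:R + 1) * (n%:R + 2) * (n%:R + 3)))).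
Proof.
have e : (4 * n.+3 = (4 * n + 6) + 6)%N by rewrite -[n.+3]addn3 mulnDr -addnA.
have p j : 0 < n%:R + j.+1%:R :> R by rewrite ltr_wpDl.
have p1 := p 0%N; have p2 := p 1%N; have p3 := p 2%N.
have s j m : (m + j.+1)%:R = m%:R + j.+1%:R :> R by rewrite natrD.
have n1 : n.+1%:R  = n%:R + 1 :> R by rewrite -addn1 s.
have n2 : n.+2%:R = n%:R + 2 :> R by rewrite -addn2 s.
have n3 : n.+3%:R = n%:R + 3 :> R by rewrite -addn3 s.
have m1 : (4 * n).+1%:R = 4 * n%:R + 1 :> R by rewrite -natr1 natrM.
have m7 : (4 * n + 6).+1%:R = 4 * n%:R + 7 :> R by rewrite -addnS s natrM.
rewrite /sextic_coef e !sexticI_rec m1 m7 !factS !natrM n1 n2 n3.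
rewrite -[(2 * z) ^+ n.+3]/((2 * z) ^+ (3 + n)) exprD.
have f0 : n`!%:R != 0 :> R by rewrite pnatr_eq0 -lt0n fact_gt0.
field; rewrite f0/=.
by rewrite !gt_eqF.
Qed.

(** At n = 3 k the ratio of consecutive terms is 144 (k + 1/12) (k + 7/12) / 36 times 8 z^3 / (27 (k
    + 1/3) (k + 2/3) (k + 1)), which shows the parameters and the constant 144 * 8 / (36 * 27) =
    32/27. *)
Lemma sextic_coef_mul3 z k : sextic_coef z (3 * k) =
  sexticI R 0 * hyperTerm (1 / 12) (7 / 12) (1 / 3) (2 / 3) (32 / 27 * z ^+ 3) k.
Proof.
elim: k => [|k IH].
  by rewrite /sextic_coef /hyperTerm /pochhammer !big_ord0 muln0 !expr0 fact0 divr1 !mulr1 divr1 mulr1.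
have -> : (3 * k.+1 = (3 * k).+3)%N by rewrite mulnS addnC !addnS addn0.
have k0 : 0 <= k%:R :> R by [].
rewrite sextic_coef_step IH hyperTermS natrM -[k.+1%:R]natr1; field.
by rewrite !gt_eqF//; lra.
Qed.

Lemma sextic_coef_mul3S z k : sextic_coef z (3 * k).+1 =
  2 * z * sexticI R 4 * hyperTerm (5 / 12) (11 / 12) (2 / 3) (4 / 3) (32 / 27 * z ^+ 3) k.
Proof.
elim: k => [|k IH].
  rewrite /sextic_coef /hyperTerm /pochhammer !big_ord0 muln0 muln1 expr1 expr0.
  by rewrite (_ : 1`! = 1)%N// !divr1 !mulr1 divr1 mulr1 mulrC.
have -> : ((3 * k.+1).+1 = (3 * k).+1.+3)%N by rewrite mulnS addnC !addnS addn0.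
have k0 : 0 <= k%:R :> R by [].
rewrite sextic_coef_step IH hyperTermS -[(3 * k).+1%:R]natr1 -[k.+1%:R]natr1 natrM; field.
by rewrite !gt_eqF//; lra.
Qed.

Lemma sextic_coefN z n : sextic_coef (- z) n = (-1) ^+ n * sextic_coef z n.
Proof. by rewrite /sextic_coef mulrN [(- (2 * z)) ^+ n]exprNn; ring. Qed.

Lemma cosDnpi (x : R) k : cos (x + k%:R * pi) = (-1) ^+ k * cos x.
Proof.
elim: k => [|k IH]; first by rewrite mul0r addr0 expr0 mul1r.
have -> : x + k.+1%:R * pi = x + k%:R * pi + pi by rewrite -natr1; ring.
by rewrite cosDpi IH exprS; ring.
Qed.

(** In the second term the change of z into - z gives the sign (-1)^(3 k + j), and the phase differs
    from the displayed one by k pi, which gives (-1)^k; only (-1)^j is left. *)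
Lemma sextic_term_pair z b k (j : nat) :
  sextic_coef z (3 * k + j) * cos (b - pi / 6 - (3 * k + j)%:R * (pi / 6)) +
  sextic_coef (- z) (3 * k + j) * cos (- b - pi / 6 - (3 * k + j)%:R * (pi / 6)) =
  sextic_coef z (3 * k + j) * (cos (b - k%:R * (pi / 2) - j.+1%:R * (pi / 6)) +
    (-1) ^+ j * cos (b - k%:R * (pi / 2) + j.+1%:R * (pi / 6))).
Proof.
have -> : b - pi / 6 - (3 * k + j)%:R * (pi / 6) = b - k%:R * (pi / 2) - j.+1%:R * (pi / 6).
  by rewrite -natr1 natrD natrM; field.
have -> : - b - pi / 6 - (3 * k + j)%:R * (pi / 6) =
    - (b - k%:R * (pi / 2) + j.+1%:R * (pi / 6) + k%:R * pi).
  by rewrite -natr1 natrD natrM; field.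
rewrite cosN cosDnpi sextic_coefN exprD mulnC exprM.
have s2 : (-1) ^+ k * (-1) ^+ k = 1 :> R by rewrite -exprMn mulrNN mulr1 expr1n.
have -> : ((-1) ^+ k) ^+ 3 = (-1) ^+ k :> R by rewrite !exprS expr0 mulr1 mulrA s2 mul1r.
rewrite mulrDr; congr (_ + _).
transitivity ((-1) ^+ k * (-1) ^+ k * ((-1) ^+ j * sextic_coef z (k * 3 + j) *
  cos (b - k%:R * (pi / 2) + j.+1%:R * (pi / 6)))); first by ring.
by rewrite s2; ring.
Qed.

(** With c = b - k pi/2, the pairs are 2 cos c cos (pi/6) for j = 0, 2 sin c sin (pi/3) for j = 1,
    and cos (c - pi/2) + cos (c + pi/2) = 0 for j = 2. The common factor is due to sin (pi/3) = cos
    (pi/6). *)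
Lemma sextic_term3 z b k :
  let f n := sextic_coef z n * cos (b - pi / 6 - n%:R * (pi / 6)) +
    sextic_coef (- z) n * cos (- b - pi / 6 - n%:R * (pi / 6)) in
  f (3 * k)%N + f (3 * k).+1 + f (3 * k).+2 = 2 * cos (pi / 6) *
   (sextic_coef z (3 * k) * cos (b - k%:R * (pi / 2)) +
    sextic_coef z (3 * k).+1 * sin (b - k%:R * (pi / 2))).
Proof.
move=> f; rewrite /f.
have := sextic_term_pair z b k 0; rewrite addn0 => ->.
have := sextic_term_pair z b k 1; rewrite addn1 => ->.
have := sextic_term_pair z b k 2; rewrite addn2 => ->.
set c := b - _.
have -> : 3 * (pi / 6) = pi / 2 :> R by field.
rewrite mul1r [cos (c - pi / 2)]cosB [cos (c + pi / 2)]cosD cos_pihalf.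
rewrite [cos (c - pi / 6)]cosB [cos (c + pi / 6)]cosD.
rewrite [cos (c - 2 * _)]cosB [cos (c + 2 * _)]cosD sin_pi3 sin_pihalf; ring.
Qed.

Lemma sextic_coef_mul3_summable z N : \sum_(k < N) `|sextic_coef z (3 * k)| <= sextic_major z.
Proof.
apply: le_trans (sextic_coef_summable z (3 * N)).
rewrite (big_ord_mul3 (fun n => `|sextic_coef z n|)) ler_sum// => k _.
by rewrite -addrA lerDl addr_ge0.
Qed.

Lemma sextic_coef_mul3S_summable z N : \sum_(k < N) `|sextic_coef z (3 * k).+1| <= sextic_major z.
Proof.
apply: le_trans (sextic_coef_summable z (3 * N)).
rewrite (big_ord_mul3 (fun n => `|sextic_coef z n|)) ler_sum// => k _.
by rewrite -addrA addrCA lerDl addr_ge0.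
Qed.

Lemma sexticJ_sum z (ua us va vs b : R) :
  \sum_(k < N) sextic_coef z (3 * k) * cos (k%:R * (pi / 2)) @[N --> \oo] --> ua ->
  \sum_(k < N) sextic_coef z (3 * k) * sin (k%:R * (pi / 2)) @[N --> \oo] --> us ->
  \sum_(k < N) sextic_coef z (3 * k).+1 * cos (k%:R * (pi / 2)) @[N --> \oo] --> va ->
  \sum_(k < N) sextic_coef z (3 * k).+1 * sin (k%:R * (pi / 2)) @[N --> \oo] --> vs ->
  sexticJ b z + sexticJ (- b) (- z) = 2 * cos (pi / 6) *
    (cos b * ua + sin b * us + (sin b * va - cos b * vs)).
Proof.
move=> hua hus hva hvs.
have h1 := @sexticJ_series R z (b - pi / 6); rewrite subrK in h1.
have h2 := @sexticJ_series R (- z) (- b - pi / 6); rewrite subrK in h2.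
(* Both series are known to converge, so their sum may be read off along the partial sums of length
   3 N, which split into residue classes. *)
have m3 : (fun N => (3 * N)%N) @ \oo --> \oo.
  by apply/cvgnyPge => A; exists A => // n /= An; rewrite (leq_trans An)// leq_pmull.
have {h1 h2}h := cvg_comp _ _ m3 (cvgD h1 h2).
have {}h := h eventually_filter.
have g : 2 * cos (pi / 6) *
   ((cos b * \sum_(k < N) sextic_coef z (3 * k) * cos (k%:R * (pi / 2)) +
     sin b * \sum_(k < N) sextic_coef z (3 * k) * sin (k%:R * (pi / 2))) +
    (sin b * \sum_(k < N) sextic_coef z (3 * k).+1 * cos (k%:R * (pi / 2)) -
     cos b * \sum_(k < N) sextic_coef z (3 * k).+1 * sin (k%:R * (pi / 2)))) @[N --> \oo] -->
   2 * cos (pi / 6) * (cos b * ua + sin b * us + (sin b * va - cos b * vs)).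
  apply: cvgMl_tmp; apply: cvgD; first by apply: cvgD; apply: cvgMl_tmp.
  by apply: cvgB; apply: cvgMl_tmp.
rewrite -(cvg_lim (@norm_hausdorff _ R) g); apply/esym/cvg_lim; first exact: norm_hausdorff.
apply: cvg_trans h; apply: near_eq_cvg; apply: nearW => N.
transitivity (\sum_(n < 3 * N) (sextic_coef z n * cos (b - pi / 6 - n%:R * (pi / 6)) +
    sextic_coef (- z) n * cos (- b - pi / 6 - n%:R * (pi / 6)))); first by rewrite big_split.
rewrite (big_ord_mul3 (fun n => sextic_coef z n * cos (b - pi / 6 - n%:R * (pi / 6)) +
    sextic_coef (- z) n * cos (- b - pi / 6 - n%:R * (pi / 6)))).
rewrite !mulr_sumr -sumrB -!big_split mulr_sumr /=; apply: eq_bigr => k _.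
by rewrite sextic_term3 cosB sinB; ring.
Qed.

Lemma umbilic_regE z e : umbilic_reg (z ^+ 2) 0 z e =
  ((2 * pi)^-1 * \int[P]_p planeF 0 z e p.1 p.2) +i*
  ((2 * pi)^-1 * \int[P]_p planeF (- (pi / 2)) z e p.1 p.2).
Proof.
rewrite /umbilic_reg /cintegral.
have h p : let xi := p.1 in let eta := p.2 in
      cexp (- 'i%C * (z ^+ 2 * xi + 0 * eta)%:C
            - 'i%C * (z * (xi ^+ 2 + eta ^+ 2))%:C
            + 'i%C * (xi ^+ 3 - 3 * xi * eta ^+ 2)%:C)
      * (expR (- e * (xi ^+ 2 + eta ^+ 2)))%:C =
   planeF 0 z e p.1 p.2 +i* planeF (- (pi / 2)) z e p.1 p.2.
  case: p => x y /=; rewrite /cexp /planeF.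
  set w := (X in complex.Re X).
  have -> : complex.Re w = 0 by rewrite /w /=; ring.
  have -> : complex.Im w = 0 - z ^+ 2 * x - z * (x ^+ 2 + y ^+ 2) + x ^+ 3 - 3 * x * y ^+ 2.
    by rewrite /w /=; ring.
  rewrite expR0; pose t := 0 - z ^+ 2 * x - z * (x ^+ 2 + y ^+ 2) + x ^+ 3 - 3 * x * y ^+ 2.
  have -> : - (pi / 2) - z ^+ 2 * x - z * (x ^+ 2 + y ^+ 2) + x ^+ 3 - 3 * x * y ^+ 2 = t - pi / 2.
    by rewrite /t; ring.
  rewrite -/t [cos (t - _)]cosB cos_pihalf sin_pihalf mulNr.
  by apply/eqP; rewrite eq_complex /=; apply/andP; split; apply/eqP; ring.
under eq_Rintegral do rewrite h/=.
under [X in _ +i* X]eq_Rintegral do rewrite h/=.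
by apply/eqP; rewrite eq_complex /=; apply/andP; split; apply/eqP; ring.
Qed.

Lemma natdivC (m n : nat) : (m%:R / n%:R : R)%:C = m%:R / n%:R.
Proof. by rewrite rmorphM fmorphV !rmorph_nat. Qed.

Lemma hyper_argE z : - (32 / 27) * 'i%C * (z ^+ 3)%:C = - 'i%C * (32 / 27 * z ^+ 3)%:C.
Proof. rewrite -(natdivC 32 27) [(32 / 27 * z ^+ 3)%:C]rmorphM !mulNr -!mulrA; congr (- _).
by rewrite mulrCA. Qed.

Lemma hyper2F2_first z (ua us : R) :
  \sum_(k < N) sextic_coef z (3 * k) * cos (k%:R * (pi / 2)) @[N --> \oo] --> ua ->
  \sum_(k < N) sextic_coef z (3 * k) * sin (k%:R * (pi / 2)) @[N --> \oo] --> us ->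
  hyper2F2 (1 / 12) (7 / 12) (1 / 3) (2 / 3) (- (32 / 27) * 'i%C * (z ^+ 3)%:C) =
  (sexticI R 0)^-1 * ua -i* ((sexticI R 0)^-1 * us).
Proof.
move=> hua hus; have [M0 _] := @sexticI0_sexticI4_gt0 R.
have hC (c : nat -> R) (l : R) : \sum_(k < N) sextic_coef z (3 * k) * c k @[N --> \oo] --> l ->
    \sum_(k < N) hyperTerm (1 / 12) (7 / 12) (1 / 3) (2 / 3) (32 / 27 * z ^+ 3) k * c k
      @[N --> \oo] --> (sexticI R 0)^-1 * l.
  move=> hl.
  have : (sexticI R 0)^-1 * (\sum_(k < N) sextic_coef z (3 * k) * c k) @[N --> \oo] -->
    (sexticI R 0)^-1 * l.
    exact: cvgMl_tmp.
  apply: cvg_trans; apply: near_eq_cvg; apply: nearW => N.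
  rewrite mulr_sumr; apply: eq_bigr => k _; rewrite sextic_coef_mul3; field.
  by rewrite gt_eqF.
have h := hyper2F2_lim (hC (fun k => cos (k%:R * (pi / 2))) _ hua)
  (hC (fun k => sin (k%:R * (pi / 2))) _ hus).
by rewrite -h -(natdivC 1 12) -(natdivC 7 12) -(natdivC 1 3) -(natdivC 2 3) hyper_argE.
Qed.

(** The terms with index 1 mod 3 all carry a factor z. Keeping it on the left yields a formula that
    includes z = 0, where both sides vanish; otherwise it is divided out. *)
Lemma hyper2F2_second z (va vs : R) :
  \sum_(k < N) sextic_coef z (3 * k).+1 * cos (k%:R * (pi / 2)) @[N --> \oo] --> va ->
  \sum_(k < N) sextic_coef z (3 * k).+1 * sin (k%:R * (pi / 2)) @[N --> \oo] --> vs ->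
  z%:C * hyper2F2 (5 / 12) (11 / 12) (2 / 3) (4 / 3) (- (32 / 27) * 'i%C * (z ^+ 3)%:C) =
  (2 * sexticI R 4)^-1 * va -i* ((2 * sexticI R 4)^-1 * vs).
Proof.
move=> hva hvs; have [_ M1] := @sexticI0_sexticI4_gt0 R.
have [z0|z0] := eqVneq z 0.
  have h0 (c : nat -> R) (l : R) :
      \sum_(k < N) sextic_coef z (3 * k).+1 * c k @[N --> \oo] --> l -> l = 0.
    move=> hl; rewrite -(cvg_lim (@norm_hausdorff _ R) hl).
    apply/cvg_lim; first exact: norm_hausdorff.
    rewrite [X in X @ _](_ : _ = cst 0); first exact: cvg_cst.
    by apply/funext => N; rewrite big1// => k _; rewrite sextic_coef_mul3S z0 mulr0 !mul0r.
  have va0 : va = 0 := h0 (fun k => cos (k%:R * (pi / 2))) _ hva.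
  have vs0 : vs = 0 := h0 (fun k => sin (k%:R * (pi / 2))) _ hvs.
  by rewrite va0 vs0 z0 !mulr0 mul0r oppr0.
have hC (c : nat -> R) (l : R) : \sum_(k < N) sextic_coef z (3 * k).+1 * c k @[N --> \oo] --> l ->
    \sum_(k < N) hyperTerm (5 / 12) (11 / 12) (2 / 3) (4 / 3) (32 / 27 * z ^+ 3) k * c k
      @[N --> \oo] --> (2 * z * sexticI R 4)^-1 * l.
  move=> hl.
  have : (2 * z * sexticI R 4)^-1 * (\sum_(k < N) sextic_coef z (3 * k).+1 * c k) @[N --> \oo] -->
    (2 * z * sexticI R 4)^-1 * l.
    exact: cvgMl_tmp.
  apply: cvg_trans; apply: near_eq_cvg; apply: nearW => N.
  rewrite mulr_sumr; apply: eq_bigr => k _; rewrite sextic_coef_mul3S; field.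
  by rewrite z0/= gt_eqF.
have -> : hyper2F2 (5 / 12) (11 / 12) (2 / 3) (4 / 3) (- (32 / 27) * 'i%C * (z ^+ 3)%:C) =
    (2 * z * sexticI R 4)^-1 * va -i* ((2 * z * sexticI R 4)^-1 * vs).
  have h := hyper2F2_lim (hC (fun k => cos (k%:R * (pi / 2))) _ hva)
    (hC (fun k => sin (k%:R * (pi / 2))) _ hvs).
  by rewrite -h -(natdivC 5 12) -(natdivC 11 12) -(natdivC 2 3) -(natdivC 4 3) hyper_argE.
apply/eqP; rewrite eq_complex /=; apply/andP; split; apply/eqP; field.
  by rewrite z0/= gt_eqF.
by rewrite z0/= gt_eqF.
Qed.

(** The Gaussian integrals contribute sqrt (pi/3), and the pairing of the two halves contributes 2
    cos (pi/6) = sqrt 3. *)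
Lemma sqrt_pi3_cos_pi6 : 2 * Num.sqrt (pi / 3) * (2 * cos (pi / 6)) = 2 * Num.sqrt pi :> R.
Proof.
have c0 : 0 <= cos (pi / 6) :> R by have [] := @cos_pi6_bounds R; lra.
have p0 : 0 <= pi :> R by exact: pi_ge0.
have p3 : 0 <= pi / 3 :> R by rewrite divr_ge0.
rewrite -mulrA; congr (_ * _).
have a0 : 0 <= Num.sqrt (pi / 3) * (2 * cos (pi / 6)) :> R.
  by rewrite !mulr_ge0 ?sqrtr_ge0.
apply/eqP; rewrite -(eqrXn2 (n := 2) _ a0 (sqrtr_ge0 _))//.
by rewrite !exprMn !sqr_sqrtr// cos_pi6_sqr; apply/eqP; field.
Qed.

End HypergeometricSums.

Theorem mainTheorem2 (R : realType) (z : R) (hz : 0 <= z) :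
  cvg (umbilic_reg (z ^+ 2) 0 z eps @[eps --> 0^'+]) /\
  umbilic (z ^+ 2) 0 z =
    (Num.sqrt pi / 3)%:C * cexp (5 * 'i%C * (z ^+ 3)%:C / 27) *
    ((Gamma (5 / 6 : R))^-1%:C *
       hyper2F2 (1 / 12) (7 / 12) (1 / 3) (2 / 3)
         (- (32 / 27) * 'i%C * (z ^+ 3)%:C)
     - 'i%C * z%:C / (3 * Gamma (7 / 6 : R))%:C *
       hyper2F2 (5 / 12) (11 / 12) (2 / 3) (4 / 3)
         (- (32 / 27) * 'i%C * (z ^+ 3)%:C)).
Proof.
have cos1 k : `|cos (k%:R * (pi / 2))| <= 1 :> R by exact: cos_max.
have sin1 k : `|sin (k%:R * (pi / 2))| <= 1 :> R by exact: sin_max.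
have [ua hua] := @cvgn_sum_bounded R (fun k => sextic_coef z (3 * k)) _ _ (sextic_coef_mul3_summable z) cos1.
have [us hus] := @cvgn_sum_bounded R (fun k => sextic_coef z (3 * k)) _ _ (sextic_coef_mul3_summable z) sin1.
have [va hva] := @cvgn_sum_bounded R (fun k => sextic_coef z (3 * k).+1) _ _
  (sextic_coef_mul3S_summable z) cos1.
have [vs hvs] := @cvgn_sum_bounded R (fun k => sextic_coef z (3 * k).+1) _ _
  (sextic_coef_mul3S_summable z) sin1.
pose phi : R := 5 * z ^+ 3 / 27.
pose L b : R := (2 * pi)^-1 * (2 * Num.sqrt pi *
  (cos b * ua + sin b * us + (sin b * va - cos b * vs))).
have p0 : 0 < pi :> R by exact: pi_gt0.
have hL b : (2 * pi)^-1 * (\int[(@lebesgue_measure R \x @lebesgue_measure R)%E]_p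
    planeF b z e p.1 p.2) @[e --> 0^'+] --> L (b + phi).
  apply: cvgMl_tmp; rewrite -sqrt_pi3_cos_pi6 -[X in _ --> X]mulrA -(sexticJ_sum _ hua hus hva hvs).
  exact: planeF_cvg.
have hlim : umbilic_reg (z ^+ 2) 0 z eps @[eps --> 0^'+] -->
    (L (0 + phi) +i* L (- (pi / 2) + phi) : R[i]^o).
  rewrite (_ : (fun e => umbilic_reg _ _ _ e) = (fun e => ((2 * pi)^-1 *
    \int[(@lebesgue_measure R \x @lebesgue_measure R)%E]_p planeF 0 z e p.1 p.2) +i*
    ((2 * pi)^-1 * \int[(@lebesgue_measure R \x @lebesgue_measure R)%E]_p
      planeF (- (pi / 2)) z e p.1 p.2))); last by apply/funext => e; exact: umbilic_regE.
  exact: (cvg_complex _ (hL 0) (hL (- (pi / 2)))).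
split; first by apply/cvg_ex; eexists; exact: hlim.
rewrite /umbilic (cvg_lim (@norm_hausdorff _ _) hlim).
rewrite (hyper2F2_first hua hus) Gamma_5_6 Gamma_7_6.
have [M0 M1] := @sexticI0_sexticI4_gt0 R; have M01 := @sexticI_reflection R.
set m0 := sexticI R 0 in M0 M01 *; set m1 := sexticI R 4 in M1 M01 *.
have := hyper2F2_second hva hvs; set H2 := hyper2F2 _ _ _ _ _ => e2.
have -> : 'i%C * z%:C / (3 * m0)%:C * H2 = 'i%C * ((3 * m0)^-1)%:C * (z%:C * H2).
  by rewrite [((3 * m0)^-1)%:C]fmorphV; ring.
rewrite e2 -/m1 /cexp.
have -> : 5 * 'i%C * (z ^+ 3)%:C / 27 = 'i%C * phi%:C.
  by rewrite /phi !(rmorphM, fmorphV, rmorph_nat); ring.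
have -> : complex.Re ('i%C * phi%:C) = 0 by rewrite /=; ring.
have -> : complex.Im ('i%C * phi%:C) = phi by rewrite /=; ring.
have s0 : 0 < Num.sqrt pi :> R by rewrite sqrtr_gt0.
have ps : pi = Num.sqrt pi ^+ 2 :> R by rewrite sqr_sqrtr// ltW.
(* Both hypergeometric terms carry 1 / (6 m0 m1) = 3 / pi, which turns the prefactor sqrt pi / 3
   into the 1 / sqrt pi of [L]. Writing pi as a square leaves sqrt pi and m0 as the only constants
   for [field]. *)
have m1E : m1 = Num.sqrt pi ^+ 2 / (18 * m0).
  have M0' : m0 != 0 by rewrite gt_eqF.
  by rewrite -ps -[m1](mulKf M0') M01; field.
rewrite expR0 add0r /L (addrC (- _) phi) cosB sinB cos_pihalf sin_pihalf m1E.
rewrite [(2 * pi)^-1](_ : _ = (2 * Num.sqrt pi ^+ 2)^-1); last by rewrite -ps.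
move: (Num.sqrt pi) s0 => s s0.
apply/eqP; rewrite eq_complex /=; apply/andP; split; apply/eqP; field.
  by rewrite !gt_eqF.
by rewrite !gt_eqF.
Qed.
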